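(* Let $\mu\in(0,1)$, let $(R_t)$ be a Bessel process of dimension $2(1-\mu)$ started from $0$, and let $g_\mu=\sup\{t\le 1: R_t=0\}$. Then $g_\mu$ follows the law $$\mathbb{P}\left(g_\mu\in dt\right)=\frac{\sin(\mu\pi)}{\pi}\,\frac{dt}{t^{1-\mu}(1-t)^{\mu}},\qquad 0<t<1,$$ i.e. the Beta law with parameters $(\mu,1-\mu)$. In particular, for a standard Brownian motion $(B_t)$ started from $0$ and $g=\sup\{t\le 1: B_t=0\}$, $$\mathbb{P}(g\in dt)=\frac{1}{\pi}\frac{dt}{\sqrt{t(1-t)}},\qquad 0<t<1,$$ i.e. $g$ is arc sine distributed.
   Context: The Bessel process of dimension $2(1-\mu)\in(0,2)$ is the nonnegative diffusion for which $0$ is instantaneously reflecting; for $\mu=1/2$ it is distributed as $|B_t|$ with $B$ a standard Brownian motion. *)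

(* Defs.v *)
From HB Require Import structures.
From mathcomp Require Import all_boot all_order all_algebra.
From mathcomp Require Import all_classical all_reals all_analysis.
Set Implicit Arguments.
Unset Strict Implicit.
Unset Printing Implicit Defensive.
Import Order.TTheory GRing.Theory Num.Theory.
Import numFieldNormedType.Exports.
Local Open Scope classical_set_scope.
Local Open Scope ring_scope.

(* Euler's Gamma and Beta integrals, for positive arguments. The library's
   beta_fun only takes natural number parameters. *)
Definition gammaR {R : realType} (a : R) : R :=
  \int[lebesgue_measure]_(x in `]0, +oo[) (x `^ (a - 1) * expR (- x)).

Definition betaR {R : realType} (a b : R) : R :=
  \int[lebesgue_measure]_(x in `]0, 1[) (x `^ (a - 1) * (1 - x) `^ (b - 1)).

Definition betaR_pdf {R : realType} (a b x : R) : R :=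
  x `^ (a - 1) * (1 - x) `^ (b - 1) / betaR a b.

(* Modified Bessel function of the first kind I_nu(z), for nu > -1 and z > 0. *)
Definition besselI {R : realType} (nu z : R) : R :=
  (z / 2) `^ nu *
  limn (series (fun k : nat =>
    (z / 2) ^+ (2 * k) / (k`!%:R * gammaR (nu + k%:R + 1)))).

(* Transition density at time t > 0, with respect to Lebesgue measure dy on
   ]0, +oo[, of the Bessel diffusion on [0, +oo[ of dimension delta > 0, of
   index nu = delta / 2 - 1:
     p_t(x,y) = (y/t) (y/x)^nu exp(-(x^2+y^2)/(2t)) I_nu(xy/t)       (x > 0),
     p_t(0,y) = 2^(-nu) t^(-(nu+1)) Gamma(nu+1)^(-1)
                y^(2nu+1) exp(-y^2/(2t)).
   For 0 < delta < 2, nu lies in ]-1, 0[ and it is I_nu (rather than I_{-nu},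
   which gives the process killed at 0) that makes 0 instantaneously
   reflecting. For delta = 1 this is the density of |x + B_t|. *)
Definition bessel_density {R : realType} (delta t x y : R) : R :=
  let nu := delta / 2 - 1 in
  if x == 0 then
    2 `^ (- nu) * t `^ (- (nu + 1)) / gammaR (nu + 1)
    * y `^ (2 * nu + 1) * expR (- (y ^+ 2 / (2 * t)))
  else
    y / t * (y / x) `^ nu * expR (- ((x ^+ 2 + y ^+ 2) / (2 * t)))
    * besselI nu (x * y / t).

Definition bessel_transition {R : realType} (delta t x : R) (U : set R)
    : \bar R :=
  (\int[lebesgue_measure]_(y in U `&` `]0%R, +oo[)
     (bessel_density delta t x y)%:E)%E.

(* Processes are indexed by R, but only times t >= 0 are ever used. *)
Section Processes.
Context {R : realType} {d : measure_display} {T : measurableType d}.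
Variable P : probability T R.
Implicit Types X : R -> {RV P >-> R}.

Definition natural_filtration X (s : R) : set (set T) :=
  <<s [set A | exists u (U : set R),
         [/\ 0 <= u <= s, measurable U & A = X u @^-1` U]] >>.

Definition continuous_paths X : Prop :=
  forall w : T, {within `[0, +oo[, continuous (fun t : R => X t w)}.

(* X is a Bessel process of dimension delta started from x0: a continuous
   [0, +oo[-valued Markov process, with the Bessel transition function.
   The last clause says
     P(X_{s+t} \in U | F_s) = bessel_transition delta t X_s U   a.s. *)
Definition bessel_process (delta x0 : R) X : Prop :=
  [/\ P [set w | X 0 w = x0] = 1%E,
      continuous_paths X,
      forall t w, 0 <= t -> 0 <= X t w &
      forall (s t : R) (A : set T) (U : set R),
        0 <= s -> 0 < t -> natural_filtration X s A -> measurable U ->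
        P (A `&` X (s + t) @^-1` U)
        = (\int[P]_(w in A) bessel_transition delta t (X s w) U)%E].

(* The last clause says that B_t - B_s is independent of F_s, with law
   N(0, t - s); the library's normal_prob takes the standard deviation. *)
Definition brownian_motion X : Prop :=
  [/\ P [set w | X 0 w = 0] = 1%E,
      continuous_paths X &
      forall (s t : R) (A : set T) (U : set R),
        0 <= s -> s < t -> natural_filtration X s A -> measurable U ->
        P (A `&` [set w | U (X t w - X s w)])
        = (P A * normal_prob 0 (Num.sqrt (t - s)) U)%E].

Definition last_zero X (w : T) : R :=
  sup [set t : R | 0 <= t <= 1 /\ X t w = 0].

Definition has_density01 (g : T -> R) (f : R -> R) : Prop :=
  measurable_fun setT g /\
  forall U : set R, measurable U ->
    P (g @^-1` U) = (\int[lebesgue_measure]_(t in U `&` `]0%R, 1%R[) (f t)%:E)%E.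

End Processes.

(* Main.v *)
(* Write Z for the process, and let nu be the law of its first zero after time t.
   Near time a, small balls at 0 have probability
     P(|Z_a| <= eta | Z_s = 0) ~ C eta^(2 - 2 mu) (a - s)^(mu - 1),
   so that splitting {|Z_a| <= eta} at the first zero after t and using the
   Markov property at that time gives the Abel equation
     int_[t, a] (a - s)^(mu - 1) nu(ds) = a^(mu - 1)            (t < a < 1).
   Multiplying by (1 - a)^(-mu) and integrating over a in ]t, 1[ yields
     P(Z vanishes in [t, 1]) B(mu, 1 - mu) = int_t^1 a^(mu - 1) (1 - a)^(-mu) da,
   and the event on the left is {t <= last zero before 1}. To avoid the strong
   Markov property, zeros are replaced by the times of a finite grid at which
   |Z| <= e, and the equation by two inequalities whose errors vanish as the grid
   is refined, then eta -> 0, then e -> 0. The constant B(mu, 1 - mu) is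
   pi / sin(pi mu), by the partial fraction expansion of the cotangent. For
   Brownian motion the same argument applies with mu = 1/2. *)
Require Import Defs.
From HB Require Import structures.
From mathcomp Require Import all_boot all_order all_algebra.
From mathcomp Require Import all_classical all_reals all_analysis.
From mathcomp Require Import measurable_realfun ring lra.
Set Implicit Arguments.
Unset Strict Implicit.
Unset Printing Implicit Defensive.
Import Order.TTheory GRing.Theory Num.Theory.
Import numFieldNormedType.Exports.
Local Open Scope classical_set_scope.
Local Open Scope ring_scope.

(** The two processes enter only through [small_ball_ge] and [small_ball_le]. Both carry the same
    constant [C], so it cancels and the Abel equation is sharp in the limit. The lower bound has a
    Gaussian loss, because at a grid hit the path is only known to be within [e] of 0; the upper
    bound is uniform in the starting point, but asks that [eta ^ 2] be at most [r * (a - s)]. The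
    two inequalities are therefore treated differently. In the upper bound for P(zero) the loss is
    controlled only while [1 - s] is bounded below, so zeros are sought in [[t, b]] with [b < 1],
    and [eta = e] suffices; [b] then tends to 1 because Z vanishes at time 1 with probability 0. In
    the lower bound, hits too close to [a] are estimated trivially. After integration over [a] they
    cost a multiple of [eta ^ 2], negligible against the main term of order [eta ^ (2 - 2 mu)]
    precisely because [mu > 0]. Paths that come within [eta] of 0 unseen by the grid are excluded by
    uniform continuity. The value of the Beta integral is needed for more than the normalisation:
    its finiteness is what allows products with it to pass to the limit. *)

Section ge0_le_integral_nomeas.
Import HBNNSimple.

(* No measurability is required: the integral of a nonnegative function is a
   supremum over the simple functions below it. *)
Lemma ge0_le_integral_nomeas d (T : measurableType d) (R : realType)
    (m : {measure set T -> \bar R}) (D : set T) (f1 f2 : T -> \bar R) :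
  (forall x, D x -> (0 <= f1 x)%E) -> (forall x, D x -> (f1 x <= f2 x)%E) ->
  (\int[m]_(x in D) f1 x <= \int[m]_(x in D) f2 x)%E.
Proof.
move=> f10 f12.
have f20 x : D x -> (0 <= f2 x)%E by move=> Dx; exact: le_trans (f10 _ Dx) (f12 _ Dx).
rewrite !ge0_integralE//; apply: le_ereal_sup => _ [h hf1 <-] /=.
exists h => // x.
by apply: (le_trans (hf1 x)); apply: lee_restrict.
Qed.

End ge0_le_integral_nomeas.

(** Integrands such as powers with exponent in []-1, 0[] blow up at an endpoint, so the compact
    fundamental theorem is applied on intervals exhausting []a, b[]. Nonnegativity gives monotone
    convergence; integrability is a conclusion, not an assumption. *)
Lemma ge0_itvoo_FTC (R : realType) (f F : R -> R) (a b la lb : R) : a < b ->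
  {in `]a, b[, forall x : R, is_derive x (1 : R) F (f x)} ->
  {in `]a, b[, continuous f} ->
  {in `]a, b[, forall x, 0 <= f x} ->
  F x @[x --> a^'+] --> la -> F x @[x --> b^'-] --> lb ->
  (\int[lebesgue_measure]_(x in `]a, b[) (f x)%:E = (lb - la)%:E)%E.
Proof.
move=> ab dF cf f0 Fa Fb.
(* The 3 gives [2 * u n < b - a] already at [n = 0], so that no interval [I n] is degenerate. *)
pose u (n : nat) : R := (b - a) / (n%:R + 3).
have u0 n : 0 < u n by rewrite divr_gt0 ?subr_gt0// ltr_wpDl.
have u2 n : 2 * u n < b - a.
  rewrite /u mulrA ltr_pdivrMr; last by rewrite ltr_wpDl.
  have n0 : 0 <= n%:R :> R by [].
  by nra.
have du m n : (m <= n)%N -> u n <= u m.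
  move=> mn; rewrite /u ler_pM2l ?subr_gt0// lef_pV2 ?posrE ?ltr_wpDl//.
  by rewrite lerD2r ler_nat.
have cu : u @ \oo --> 0.
  rewrite /u -[X in _ --> X](mulr0 (b - a)); apply: cvgMr.
  apply: (@squeeze_cvgr _ _ _ _ (fun=> 0) (@harmonic R)).
  - apply: nearW => n; rewrite invr_ge0 addr_ge0//=.
    rewrite lef_pV2 ?posrE ?ltr_wpDl//.
    by rewrite -[n.+1]addn1 natrD lerD2l; lra.
  - exact: cvg_cst.
  - exact: cvg_harmonic.
pose I (n : nat) : set R := `[a + u n, b - u n]%classic.
have subI n x : I n x -> x \in `]a, b[.
  rewrite /I /= !in_itv/= => /andP[h1 h2].
  by have := u0 n => u0n; apply/andP; split; lra.
have ndI : nondecreasing_seq I.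
  move=> m n /du umn; apply/subsetPset => x; rewrite /I /= !in_itv/= => /andP[h1 h2].
  by apply/andP; split; lra.
have -> : `]a, b[%classic = \bigcup_i I i.
  apply/seteqP; split => x /=; last by case=> i _ /subI.
  rewrite in_itv/= => /andP[ax xb].
  have /cvgrPdist_lt /(_ (Num.min (x - a) (b - x))) := cu.
  rewrite lt_min !subr_gt0 ax xb => /(_ erefl)[N _ /(_ N (leqnn N))] /=.
  rewrite sub0r normrN (gtr0_norm (u0 _)) lt_min => /andP[h1 h2].
  by exists N => //; rewrite /I/= in_itv/=; apply/andP; split; lra.
have mI i : measurable (I i) by exact: measurable_itv.
have mfI i : measurable_fun (I i) (fun x : R => (f x)%:E).
  apply/measurable_EFinP; apply: (@measurable_funS _ _ _ _ `]a, b[) => //.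
    by move=> x /subI.
  apply: open_continuous_measurable_fun; first exact: interval_open.
  by move=> x /set_mem xab; exact: cf.
have FI n : (\int[lebesgue_measure]_(x in I n) (f x)%:E =
             (F (b - u n) - F (a + u n))%:E)%E.
  have abn : a + u n < b - u n by have := u2 n; lra.
  have dab x : x \in `[a + u n, b - u n] -> x \in `]a, b[ by exact: subI.
  rewrite (@continuous_FTC2 _ f F)//.
  - apply: continuous_in_subspaceT => x /set_mem xI.
    by apply: cf; exact: dab.
  - have cF x : x \in `]a, b[ -> {for x, continuous F}.
      move=> xab; apply: differentiable_continuous; apply/derivable1_diffP.
      by have [] := dF _ xab.
    split.
    + move=> x xab; have [|//] := dF x.
      by apply: dab; exact: subset_itv_oo_cc xab.
    + apply: cvg_at_right_filter; apply: cF; apply: dab.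
      by rewrite in_itv/= lexx ltW.
    + apply: cvg_at_left_filter; apply: cF; apply: dab.
      by rewrite in_itv/= lexx ltW.
  - move=> x xab; rewrite derive1E.
    by have [|_ ->//] := dF x; apply: dab; exact: subset_itv_oo_cc xab.
have /= h : (\int[lebesgue_measure]_(x in I i) (f x)%:E @[i --> \oo] -->
    \int[lebesgue_measure]_(x in \bigcup_i I i) (f x)%:E)%E.
  apply: ge0_nondecreasing_set_cvg_integral => //.
  by move=> i x /subI /f0; rewrite lee_fin.
suff : (\int[lebesgue_measure]_(x in I i) (f x)%:E @[i --> \oo] --> (lb - la)%:E)%E.
  by move/(cvg_unique _ h) => ->.
under eq_fun do rewrite FI.
apply: cvg_EFin; first exact: nearW.
rewrite (_ : _ \o _ = fun i => F (b - u i) - F (a + u i))//.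
apply: cvgB.
- move/cvg_at_leftP : Fb; apply; split.
    by move=> n; rewrite ltrBlDr ltrDl.
  by rewrite -[X in _ --> X]subr0; apply: cvgB => //; exact: cvg_cst.
- move/cvg_at_rightP : Fa; apply; split.
    by move=> n; rewrite ltrDl.
  by rewrite -[X in _ --> X]addr0; apply: cvgD => //; exact: cvg_cst.
Qed.

Lemma pushforward_measure d d' (T1 : measurableType d) (T2 : measurableType d')
    (R : realFieldType) (m : {measure set T1 -> \bar R}) (f : T1 -> T2) :
  measurable_fun setT f ->
  exists nu : {measure set T2 -> \bar R},
    nu = pushforward m f :> (set T2 -> \bar R).
Proof.
by move=> mf; exists (measure_function_pushforward__canonical__measure_function_Measure m mf).
Qed.

(** Uniqueness of Lebesgue measure: the affine map pulls a half-open interval back to one whose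
    length is divided by [k]. *)
Lemma lebesgue_measure_affine (R : realType) (b k : R) :
  0 < k ->
  exists2 m : {measure set (measurableTypeR R) -> \bar R},
  m = pushforward lebesgue_measure
     ((fun x : R => b + k * x)%R : measurableTypeR R -> measurableTypeR R)
     :> (set (measurableTypeR R) -> \bar R) &
  forall A, measurable A -> lebesgue_measure A = (k%:E * m A)%E.
Proof.
move=> k0.
have mphi : @measurable_fun _ _ (measurableTypeR R) (measurableTypeR R) setT
    (fun x : R => b + k * x).
  apply: continuous_measurable_fun => x.
  by apply: cvgD; [exact: cvg_cst|apply: cvgMr; exact: cvg_id].
have [nu nuE] := pushforward_measure lebesgue_measure mphi.
exists nu => // A mA.
suff : lebesgue_measure A = mscale (NngNum (ltW k0)) nu A by [].
apply: lebesgue_measure_unique => //= _ [[x y]] _ <-.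
rewrite /mscale/= nuE /pushforward/=.
have -> : (fun x : R => b + k * x) @^-1` `]x, y] = `](x - b) / k, (y - b) / k]%classic.
  apply/seteqP; split => z /=; rewrite !in_itv/= ltr_pdivrMr// ler_pdivlMr// (mulrC z);
  by rewrite ltrBlDl lerBrDl.
rewrite !lebesgue_measure_itv/= !lte_fin ltr_pM2r ?invr_gt0// ltrD2r.
case: ifP => _; last by rewrite mule0.
rewrite -!EFinD -EFinM; congr EFin; field; exact: lt0r_neq0.
Qed.

Lemma ge0_integral_affine (R : realType) (b k : R) (D : set R) (f : R -> \bar R) :
  0 < k -> measurable D -> measurable_fun D f -> (forall x, D x -> (0 <= f x)%E) ->
  (\int[lebesgue_measure]_(x in D) f x =
   k%:E * \int[lebesgue_measure]_(x in (fun x : R => b + k * x)%R @^-1` D) f (b + k * x)%R)%E.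
Proof.
move=> k0 mD mf f0.
have mphi : @measurable_fun _ _ (measurableTypeR R) (measurableTypeR R) setT
    (fun x : R => b + k * x).
  apply: continuous_measurable_fun => x.
  by apply: cvgD; [exact: cvg_cst|apply: cvgMr; exact: cvg_id].
rewrite -[X in (_ = _ * X)%E](@ge0_integral_pushforward _ _ _ _ R _ mphi lebesgue_measure D f mD mf);
  last by move=> x /set_mem; exact: f0.
have [m mE lebE] := lebesgue_measure_affine b k0.
rewrite -mE -(@ge0_integral_mscale _ _ _ m D mD (NngNum (ltW k0)) f)//.
apply: eq_measure_integral => //= A mA _; exact: lebE.
Qed.

Ltac neq0_lra := repeat (apply/andP; split);
  first [exact: lt0r_neq0 | apply: lt0r_neq0; lra | apply: ltr0_neq0; lra | idtac].

(** * Partial fractions of the cotangent *)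

Section cotangent_expansion.
Variable R : realType.
Implicit Types (x y : R) (N : nat).

(** Paired terms of Euler's expansion of pi cot(pi x), shifted so that index 0 is the pair of poles
    -1 and 1. [csc_psum] truncates the expansion of pi / sin(pi x): same poles, alternating
    signs. *)
Definition cot_term x (i : nat) : R := (x + (i%:R + 1))^-1 + (x - (i%:R + 1))^-1.

Definition cot_psum N x : R := x^-1 + \sum_(0 <= i < N) cot_term x i.

Definition csc_psum N x : R :=
  x^-1 + \sum_(0 <= i < N) (-1) ^+ i.+1 * cot_term x i.

(** Truncates the series for the integral of u^(x-1) / (1+u) over []0, 1[]. *)
Definition alt_psum N x : R := \sum_(0 <= i < N) (-1) ^+ i / (x + i%:R).

(** Halving the argument keeps only the even poles, with doubled residue; even poles counted twice
    minus all poles is the alternating sum. *)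
Lemma cot_psum_half N x : 0 < x < 1 ->
  csc_psum N.*2 x = cot_psum N (x / 2) - cot_psum N.*2 x.
Proof.
move=> /andP[x0 x1]; elim: N => [|N IH].
  rewrite /csc_psum /cot_psum !big_nil; field.
  by rewrite !lt0r_neq0.
rewrite doubleS.
have -> : csc_psum N.*2.+2 x = csc_psum N.*2 x - cot_term x N.*2 + cot_term x N.*2.+1.
  rewrite /csc_psum !big_nat_recr//= !exprS -mul2n exprM sqrrN expr1n expr1n; ring.
have -> : cot_psum N.+1 (x / 2) = cot_psum N (x / 2) + cot_term (x / 2) N.
  by rewrite /cot_psum big_nat_recr//= addrA.
have -> : cot_psum N.*2.+2 x = cot_psum N.*2 x + cot_term x N.*2 + cot_term x N.*2.+1.
  by rewrite /cot_psum !big_nat_recr//= !addrA.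
have e2 : N.*2%:R = 2 * N%:R :> R by rewrite -mul2n natrM.
have e3 : N.*2.+1%:R = 2 * N%:R + 1 :> R by rewrite -addn1 natrD e2.
rewrite {}IH /cot_term e3 e2.
have : 0 <= N%:R :> R by [].
move: N%:R => n n0; field.
by neq0_lra.
Qed.

(** The first sum has the even poles and the second the odd ones. The latter run from [-(2N+1)] to
    [2N-1], so the pole at [-(2N+1)] has no counterpart in [cot_psum N.*2] and gives the extra
    term. *)
Lemma cot_psum_duplication N x : 0 < x < 1 ->
  cot_psum N (x / 2) + cot_psum N ((x + 1) / 2)
    = 2 * cot_psum N.*2 x + 2 / (x + 2 * N%:R + 1).
Proof.
move=> /andP[x0 x1]; elim: N => [|N IH].
  rewrite /cot_psum !big_nil mulr0 !addr0; field.
  by neq0_lra.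
have cS M y : cot_psum M.+1 y = cot_psum M y + cot_term y M.
  by rewrite /cot_psum big_nat_recr//= addrA.
have e2 : N.*2%:R = 2 * N%:R :> R by rewrite -mul2n natrM.
have e3 : N.*2.+1%:R = 2 * N%:R + 1 :> R by rewrite -addn1 natrD e2.
have e1 : N.+1%:R = N%:R + 1 :> R by rewrite -addn1 natrD.
rewrite doubleS !cS addrACA {}IH /cot_term e1 e3 e2.
have : 0 <= N%:R :> R by [].
move: N%:R => n n0; field.
by neq0_lra.
Qed.

(** Reflection moves the window of poles from [[-N, N]] to [[1-N, N+1]]; the two extra terms adjust
    its ends. *)
Lemma cot_psum_reflect N x : 0 < x < 1 ->
  cot_psum N (1 - x) = - (cot_psum N x + (x - N%:R - 1)^-1 - (x + N%:R)^-1).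
Proof.
move=> /andP[x0 x1]; elim: N => [|N IH].
  rewrite /cot_psum !big_nil subr0 !addr0; field.
  by neq0_lra.
have cS M y : cot_psum M.+1 y = cot_psum M y + cot_term y M.
  by rewrite /cot_psum big_nat_recr//= addrA.
have e1 : N.+1%:R = N%:R + 1 :> R by rewrite -addn1 natrD.
rewrite !cS {}IH /cot_term e1.
have : 0 <= N%:R :> R by [].
move: N%:R => n n0; field.
by neq0_lra.
Qed.

(** Since 1/(1-x+i) = -1/(x-(i+1)), the sum at [1 - x] supplies the positive poles and the sum at
    [x] the others, except the pole at [-N]. *)
Lemma csc_psumE N x : 0 < x < 1 ->
  alt_psum N x + alt_psum N (1 - x) = csc_psum N x - (-1) ^+ N / (x + N%:R).
Proof.
move=> /andP[x0 x1]; elim: N => [|N IH].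
  by rewrite /alt_psum /csc_psum !big_nil expr0 !addr0 div1r subrr.
have aS y : alt_psum N.+1 y = alt_psum N y + (-1) ^+ N / (y + N%:R).
  by rewrite /alt_psum big_nat_recr.
have cS : csc_psum N.+1 x = csc_psum N x + (-1) ^+ N.+1 * cot_term x N.
  by rewrite /csc_psum big_nat_recr//= addrA.
have e1 : N.+1%:R = N%:R + 1 :> R by rewrite -addn1 natrD.
rewrite !aS cS addrACA {}IH /cot_term exprS e1.
have : 0 <= N%:R :> R by [].
move: N%:R ((-1) ^+ N) => n e n0; field.
by neq0_lra.
Qed.

(** For [x <= 1/2], [n + 1 - x] is at least [(n + 1) / 2], so the difference quotient is at most
    [(1 + 4) / (n + 1) ^ 2]. The bound is put in telescoping form, so that it sums to at most 10. *)
Lemma cot_term_lipschitz i x y : 0 <= x <= 1 / 2 -> 0 <= y <= 1 / 2 ->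
  `|cot_term x i - cot_term y i| <=
  10 * ((i%:R + 1)^-1 - (i%:R + 2)^-1) * `|x - y|.
Proof.
move=> /andP[x0 x1] /andP[y0 y1]; rewrite /cot_term.
have : 0 <= i%:R :> R by [].
move: i%:R => n n0.
have -> : (x + (n + 1))^-1 + (x - (n + 1))^-1 - ((y + (n + 1))^-1 + (y - (n + 1))^-1) =
  - (x - y) * (((x + (n + 1)) * (y + (n + 1)))^-1 + ((n + 1 - x) * (n + 1 - y))^-1).
  field.
  by neq0_lra.
rewrite normrM normrN [leLHS]mulrC ler_wpM2r//.
have h1 : ((x + (n + 1)) * (y + (n + 1)))^-1 <= ((n + 1) * (n + 1))^-1.
  by rewrite lef_pV2 ?posrE; [apply: ler_pM; lra|apply: mulr_gt0; lra..].
have h2 : ((n + 1 - x) * (n + 1 - y))^-1 <= ((n + 1) / 2 * ((n + 1) / 2))^-1.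
  by rewrite lef_pV2 ?posrE; [apply: ler_pM; lra|apply: mulr_gt0; lra..].
have h3 : 0 <= ((x + (n + 1)) * (y + (n + 1)))^-1.
  by rewrite invr_ge0; apply: mulr_ge0; lra.
have h4 : 0 <= ((n + 1 - x) * (n + 1 - y))^-1.
  by rewrite invr_ge0; apply: mulr_ge0; lra.
rewrite ger0_norm ?addr_ge0//.
apply: (le_trans (lerD h1 h2)).
rewrite -subr_ge0.
have -> : 10 * ((n + 1)^-1 - (n + 2)^-1) -
  (((n + 1) * (n + 1))^-1 + ((n + 1) / 2 * ((n + 1) / 2))^-1) =
  (5 * n) / ((n + 1) ^+ 2 * (n + 2)).
  field.
  by neq0_lra.
by rewrite divr_ge0 ?mulr_ge0 ?exprn_ge0 ?addr_ge0.
Qed.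

Lemma cot_psum_lipschitz N x y : 0 <= x <= 1 / 2 -> 0 <= y <= 1 / 2 ->
  `|(cot_psum N x - x^-1) - (cot_psum N y - y^-1)| <= 10 * `|x - y|.
Proof.
move=> hx hy.
have -> : (cot_psum N x - x^-1) - (cot_psum N y - y^-1) =
    \sum_(0 <= i < N) (cot_term x i - cot_term y i).
  by rewrite sumrB /cot_psum; ring.
apply: (le_trans (ler_norm_sum _ _ _)).
have : \sum_(0 <= i < N) `|cot_term x i - cot_term y i| <=
    \sum_(0 <= i < N) 10 * ((i%:R + 1)^-1 - (i%:R + 2)^-1) * `|x - y|.
  by apply: ler_sum => i _; exact: cot_term_lipschitz.
move=> /le_trans; apply.
rewrite -mulr_suml -mulr_sumr ler_wpM2r// -[leRHS]mulr1 ler_wpM2l//.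
have -> : \sum_(0 <= i < N) ((i%:R + 1)^-1 - (i%:R + 2)^-1) = 1 - (N%:R + 1)^-1 :> R.
  elim: N => [|N IH]; first by rewrite big_nil add0r invr1 subrr.
  rewrite big_nat_recr//= IH -[N.+1]addn1 natrD addrA subrK.
  by rewrite -(addrA N%:R 1 1).
by rewrite gerBl invr_ge0 addr_ge0.
Qed.

Lemma cvg_add_natr_inv (a b : R) : 0 < b ->
  (a + b * n%:R)^-1 @[n --> \oo] --> (0 : R).
Proof.
move=> b0; apply/(@gtr0_cvgV0 _ _ _ _ (fun n => a + b * n%:R)).
  near=> n; rewrite -ltrBlDl sub0r mulrC -ltr_pdivrMr//.
  by near: n; exact: nbhs_infty_gtr.
apply/cvgryPgt => A; near=> n.
rewrite -ltrBlDl mulrC -ltr_pdivrMr//.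
by near: n; exact: nbhs_infty_gtr.
Unshelve. all: by end_near. Qed.

Lemma is_cvg_cot_psum x : 0 < x <= 1 / 2 -> cvg (cot_psum N x @[N --> \oo]).
Proof.
move=> /andP[x0 x1]; apply: nonincreasing_is_cvgn.
  apply/nonincreasing_seqP => N; rewrite /cot_psum big_nat_recr//= addrA gerDl.
  rewrite /cot_term; have : 0 <= N%:R :> R by [].
  move: N%:R => n n0.
  have -> : (x + (n + 1))^-1 + (x - (n + 1))^-1 =
            - (2 * x / ((n + 1 + x) * (n + 1 - x))).
    field.
    by neq0_lra.
  by rewrite oppr_le0 divr_ge0//; [lra|apply: mulr_ge0; lra].
exists (x^-1 - 10 * `|x - 0|) => _ [N _ <-].
(* Comparing with 0 is legitimate because [0^-1] is 0, whence [cot_psum N 0 = 0]; this bounds the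
   decreasing sequence from below. *)
have := @cot_psum_lipschitz N x 0.
rewrite (ltW x0) x1 lexx => /(_ isT); rewrite divr_ge0// => /(_ isT).
have -> : cot_psum N 0 = 0.
  rewrite /cot_psum invr0 add0r big1// => i _.
  by rewrite /cot_term add0r sub0r invrN subrr.
by rewrite invr0 !subr0 ler_norml => /andP[h _]; rewrite lerBlDr; lra.
Qed.

Lemma ge0_of_derive (F f : R -> R) : (forall x, is_derive x (1 : R) F (f x)) ->
  F 0 = 0 -> (forall x, 0 <= x -> 0 <= f x) -> forall x, 0 <= x -> 0 <= F x.
Proof.
move=> dF F0 f0 x x0.
have [|c /itvP cx] := @MVT_segment R F f 0 x x0 (fun z _ => dF z).
  apply: continuous_subspaceT => z; apply: differentiable_continuous.
  by apply/derivable1_diffP; have [] := dF z.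
rewrite F0 subr0 => ->; rewrite subr0 mulr_ge0// f0//.
by rewrite cx.
Qed.

Lemma sin_le x : 0 <= x -> sin x <= x.
Proof.
move=> x0; rewrite -subr_ge0.
apply: (@ge0_of_derive (fun x => x - sin x) (fun x => 1 - cos x)) => //.
by rewrite sin0 subrr.
Qed.

Lemma cos_ge x : 0 <= x -> 1 - x ^+ 2 / 2 <= cos x.
Proof.
move=> x0; rewrite -subr_ge0.
apply: (@ge0_of_derive (fun x => cos x - (1 - x ^+ 2 / 2)) (fun x => x - sin x)) => //.
- by move=> z; apply: is_derive_eq; rewrite /GRing.scale/=; field.
- by rewrite cos0 expr0n/= mul0r subr0 subrr.
- by move=> z z0; rewrite subr_ge0 sin_le.
Qed.

Lemma sin_ge x : 0 <= x -> x - x ^+ 3 / 6 <= sin x.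
Proof.
move=> x0; rewrite -subr_ge0.
apply: (@ge0_of_derive (fun x => sin x - (x - x ^+ 3 / 6))
  (fun x => cos x - (1 - x ^+ 2 / 2))) => //.
- by move=> z; apply: is_derive_eq; rewrite /GRing.scale/=; field.
- by rewrite sin0 expr0n/= mul0r subr0 subrr.
- by move=> z z0; rewrite subr_ge0 cos_ge.
Qed.

(** Normalised to have residue 1 at every integer, like [cot_psum]. *)
Definition cot x : R := pi * cos (pi * x) / sin (pi * x).

Lemma sin_pi_gt0 x : 0 < x < 1 -> 0 < sin (pi * x).
Proof.
move=> /andP[x0 x1]; apply: sin_gt0_pi.
by rewrite mulr_gt0 ?pi_gt0//= gtr_pMr// pi_gt0.
Qed.

Lemma cot_duplication x : 0 < x < 1 ->
  cot (x / 2) + cot ((x + 1) / 2) = 2 * cot x.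
Proof.
move=> /andP[x0 x1]; rewrite /cot.
have -> : pi * ((x + 1) / 2) = pi * (x / 2) + pi / 2 by field.
have -> : pi * x = (pi * (x / 2)) *+ 2 by rewrite -mulrnAr -mulr_natr divfK.
rewrite cosDpihalf sinDpihalf sin_mulr2n cos_mulr2n.
have s0 : sin (pi * (x / 2)) != 0.
  by apply/lt0r_neq0/sin_pi_gt0; apply/andP; split; lra.
have c0 : cos (pi * (x / 2)) != 0.
  have := @pi_gt0 R => pi0.
  by apply/lt0r_neq0/cos_gt0_pihalf; apply/andP; split; nra.
have := cos2Dsin2 (pi * (x / 2)).
move: (cos _) (sin _) s0 c0 => c s s0 c0 e.
have -> : c ^+ 2 *+ 2 - 1 = c ^+ 2 - s ^+ 2 by rewrite -e mulr2n; ring.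
rewrite -mulr_natr; field.
by rewrite s0 c0.
Qed.

Lemma cot_reflect x : cot (1 - x) = - cot x.
Proof.
rewrite /cot mulrBr mulr1 cosB sinB cospi sinpi !mul0r addr0 sub0r !mulN1r.
by rewrite opprK mulrN mulNr.
Qed.

Lemma cot_csc x : 0 < x < 1 -> cot (x / 2) - cot x = pi / sin (pi * x).
Proof.
move=> x01; rewrite /cot.
have s1 : sin (pi * (x / 2)) != 0.
  by case/andP: x01 => x0 x1; apply/lt0r_neq0/sin_pi_gt0; apply/andP; split; lra.
have := sin_pi_gt0 x01 => /lt0r_neq0.
have -> : pi * x = (pi * (x / 2)) *+ 2 by rewrite -mulrnAr -mulr_natr divfK.
rewrite sin_mulr2n cos_mulr2n => s2.
have := cos2Dsin2 (pi * (x / 2)).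
move: (cos _) (sin _) s1 s2 => c s s1; rewrite -mulr_natr => s2 e.
have -> : c ^+ 2 *+ 2 - 1 = c ^+ 2 - s ^+ 2 by rewrite -e mulr2n; ring.
have c0 : c != 0 by apply: contra_neq s2 => ->; rewrite mul0r mul0r.
apply/eqP; rewrite -subr_eq0; apply/eqP.
have -> : pi * c / s - pi * (c ^+ 2 - s ^+ 2) / (c * s * 2%:R) - pi / (c * s * 2%:R) =
  pi * (c ^+ 2 + s ^+ 2 - 1) / (c * s * 2%:R).
  by field; rewrite s1 c0.
by rewrite e subrr mulr0 mul0r.
Qed.

(** The derivative of [cot x - x^-1] is [x ^- 2 - (pi / sin (pi x)) ^ 2]. With [t = pi x] and
    [s = sin t], bounding it by [3 * pi ^ 2] amounts to [t^2 - s^2 <= 3 t^2 s^2]. *)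
Lemma cot_lipschitz x y : 0 < x <= 1 / 2 -> 0 < y <= 1 / 2 ->
  `|(cot x - x^-1) - (cot y - y^-1)| <= 3 * pi ^+ 2 * `|x - y|.
Proof.
wlog xy : x y / x <= y.
  move=> H hx hy; have [xy|/ltW yx] := leP x y; first exact: H.
  by rewrite distrC (distrC x); exact: H.
move=> /andP[x0 x1] /andP[y0 y1].
pose F (z : R) := cot z - z^-1.
pose f (z : R) := - (pi / sin (pi * z)) ^+ 2 + z^-1 ^+ 2.
have pi0 := @pi_gt0 R.
have dF (z : R) : 0 < z <= 1 / 2 -> is_derive z (1 : R) F (f z).
  move=> /andP[z0 z1].
  have sz : sin (pi * z) != 0 by apply/lt0r_neq0/sin_pi_gt0; apply/andP; split; lra.
  have d1 : is_derive z (1 : R) (fun z => pi * z) pi.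
    by apply: is_derive_eq; rewrite /GRing.scale/= mulr1.
  have d2 : is_derive z (1 : R) (fun z => sin (pi * z)) (cos (pi * z) * pi).
    exact: (@is_derive1_comp _ sin (fun z => pi * z)).
  have d3 : is_derive z (1 : R) (fun z => cos (pi * z)) (- sin (pi * z) * pi).
    exact: (@is_derive1_comp _ cos (fun z => pi * z)).
  have d4 := is_deriveV sz d2.
  have d5 := @is_deriveV _ id z (1 : R) (1 : R) (lt0r_neq0 z0) (is_derive_id z (1 : R)).
  have d6 := is_deriveB (is_deriveM (is_deriveM (@is_derive_cst R R R (pi : R) z (1 : R)) d3) d4) d5.
  apply: (is_derive_eq d6); rewrite /GRing.scale/= /f.
  rewrite [(_ * _) z](_ : _ = pi * cos (pi * z))//.
  have := cos2Dsin2 (pi * z).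
  move: (cos _) (sin _) sz => c s sz e.
  have -> : (pi / s) ^+ 2 = pi ^+ 2 * (c ^+ 2 + s ^+ 2) / s ^+ 2.
    by rewrite e mulr1; field.
  by field; rewrite sz lt0r_neq0.
have f3 (z : R) : 0 < z <= 1 / 2 -> `|f z| <= 3 * pi ^+ 2.
  move=> /andP[z0 z1]; rewrite /f.
  have t0 : 0 < pi * z by rewrite mulr_gt0.
  have t2 : pi * z <= 2 by have := @pihalf_lt2 R; nra.
  have -> : z^-1 = pi / (pi * z) by rewrite invfM mulrA divff ?mul1r ?lt0r_neq0.
  have := sin_le (ltW t0); have := sin_ge (ltW t0).
  move: (pi * z) t0 t2 (sin (pi * z)) => t t0 t2 s h1 h2.
  have h3 : t / 3 <= s by apply: le_trans h1; nra.
  have s0 : 0 < s by apply: lt_le_trans h3; rewrite divr_gt0.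
  have -> : - (pi / s) ^+ 2 + (pi / t) ^+ 2 = - (pi ^+ 2 * ((t ^+ 2 - s ^+ 2) / (t ^+ 2 * s ^+ 2))).
    by field; rewrite (lt0r_neq0 s0) (lt0r_neq0 t0).
  rewrite normrN normrM (ger0_norm (sqr_ge0 pi)) [leRHS]mulrC ler_wpM2l ?sqr_ge0//.
  have ts0 : 0 < t ^+ 2 * s ^+ 2 by rewrite mulr_gt0 ?exprn_gt0.
  rewrite ger0_norm; last first.
    apply: divr_ge0 (ltW ts0); rewrite subr_ge0.
    by apply: lerXn2r => //; rewrite nnegrE ltW.
  rewrite ler_pdivrMr//.
  (* [h4] yields [t^2 - s^2 <= t^4 / 3], the term in [t^6] having the favourable sign, and [h5]
     yields [t^4 / 3 <= 3 t^2 s^2]. *)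
  have h4 : (t - t ^+ 3 / 6) ^+ 2 <= s ^+ 2.
    by apply: lerXn2r; rewrite ?nnegrE ?(ltW s0)//; nra.
  have h5 : (t / 3) ^+ 2 <= s ^+ 2.
    by apply: lerXn2r; rewrite ?nnegrE ?(ltW s0)//; lra.
  have h6 : 0 <= t ^+ 2 * (s ^+ 2 - (t / 3) ^+ 2) by rewrite mulr_ge0 ?sqr_ge0 ?subr_ge0.
  have h7 : 0 <= t ^+ 6 by rewrite exprn_ge0 ?ltW.
  nra.
have [| |c /itvP cxy] := @MVT_segment R F f x y xy.
- by move=> z /itvP zxy; apply: dF; rewrite (lt_le_trans x0) ?zxy//= (le_trans _ y1) ?zxy.
- have cF (z : R) : 0 < z <= 1 / 2 -> {for z, continuous F}.
    by move=> /dF dFz; apply: differentiable_continuous; apply/derivable1_diffP; have [] := dFz.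
  apply: continuous_in_subspaceT => z /set_mem/itvP zxy; apply: cF.
  by rewrite (lt_le_trans x0) ?zxy//= (le_trans _ y1) ?zxy.
rewrite -/(F x) -/(F y) distrC => ->; rewrite normrM (distrC x) ler_wpM2r// f3//.
by rewrite (lt_le_trans x0) ?cxy//= (le_trans _ y1) ?cxy.
Qed.

Lemma cvg_double (u : R^nat) (l : R) : u @ \oo --> l -> u N.*2 @[N --> \oo] --> l.
Proof.
move=> ul; apply: cvg_comp ul.
apply/cvgnyPge => A; near=> n.
by rewrite -addnn (@leq_trans n) ?leq_addr//; near: n; exact: nbhs_infty_ge.
Unshelve. all: by end_near. Qed.

(* Herglotz' trick: the difference g of the two sides is Lipschitz and satisfies
   2 g(y) = g(y/2) - g((1-y)/2), so its Lipschitz constant can be halved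
   indefinitely; g is thus constant, and the functional equation makes it 0. *)
Lemma cvg_cot_psum_half x : 0 < x <= 1 / 2 ->
  cot_psum N x @[N --> \oo] --> cot x.
Proof.
move=> hx; suff -> : cot x = limn (cot_psum ^~ x) by exact: is_cvg_cot_psum.
pose c y := limn (cot_psum ^~ y); rewrite -/(c x).
pose g y := c y - cot y.
have cE y : 0 < y <= 1 / 2 -> cot_psum ^~ y @ \oo --> c y by exact: is_cvg_cot_psum.
have cdup y : 0 < y <= 1 / 2 -> c (y / 2) - c ((1 - y) / 2) = 2 * c y.
  move=> /andP[y0 y1].
  have /cE h1 : 0 < y / 2 <= 1 / 2 by lra.
  have /cE h2 : 0 < (1 - y) / 2 <= 1 / 2 by lra.
  have /cE/cvg_double h3 : 0 < y <= 1 / 2 by rewrite y0.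
  have h4 : cot_psum N (y / 2) - cot_psum N ((1 - y) / 2) @[N --> \oo] -->
      c (y / 2) - c ((1 - y) / 2) by exact: cvgB.
  apply: (cvg_unique _ h4) => //.
  (* [(y + 1) / 2] lies beyond 1/2, where convergence is not yet known; reflection replaces it by
     [z], at the price of boundary terms that tend to 0. *)
  pose z := (1 - y) / 2.
  have -> : (fun N => cot_psum N (y / 2) - cot_psum N ((1 - y) / 2)) =
      (fun N => 2 * cot_psum N.*2 y + 2 * (y + 1 + 2 * N%:R)^-1
        - (1 - z + 1 * N%:R)^-1 - (z + 1 * N%:R)^-1).
    apply/funext => N.
    have y01 : 0 < y < 1 by lra.
    have z01 : 0 < z < 1 by rewrite /z; lra.
    have := cot_psum_duplication N y01.
    have -> : (y + 1) / 2 = 1 - z by rewrite /z; field.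
    rewrite (cot_psum_reflect N z01) -/z !mul1r (addrAC y 1).
    have -> : (z - N%:R - 1)^-1 = - (1 - z + N%:R)^-1.
      by rewrite -invrN; congr (_^-1); ring.
    lra.
  have -> : 2 * c y = 2 * c y + 0 - 0 - 0 by rewrite addr0 !subr0.
  apply: cvgB; last exact: cvg_add_natr_inv.
  apply: cvgB; last exact: cvg_add_natr_inv.
  apply: cvgD; first exact: cvgMr.
  by rewrite -[X in _ --> X](mulr0 2); apply: cvgMr; exact: cvg_add_natr_inv.
have gdup y : 0 < y <= 1 / 2 -> g y = (g (y / 2) - g ((1 - y) / 2)) / 2.
  move=> hy; have := cdup _ hy; have y01 : 0 < y < 1 by lra.
  have := cot_duplication y01.
  have -> : (y + 1) / 2 = 1 - (1 - y) / 2 by field.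
  by rewrite cot_reflect /g; lra.
pose L : R := 10 + 3 * pi ^+ 2.
have glip y z : 0 < y <= 1 / 2 -> 0 < z <= 1 / 2 -> `|g y - g z| <= L * `|y - z|.
  move=> hy hz.
  have -> : g y - g z = ((c y - y^-1) - (c z - z^-1)) -
    ((cot y - y^-1) - (cot z - z^-1)) by rewrite /g; ring.
  apply: (le_trans (ler_normB _ _)); rewrite /L mulrDl lerD ?cot_lipschitz//.
  have h : `|(cot_psum N y - y^-1) - (cot_psum N z - z^-1)| @[N --> \oo] -->
      `|(c y - y^-1) - (c z - z^-1)|.
    apply: cvg_norm; apply: cvgB; apply: cvgB; try exact: cvg_cst; exact: cE.
  rewrite -(cvg_lim _ h)//; apply: limr_le; first by apply/cvg_ex; exists (`|(c y - y^-1) - (c z - z^-1)|).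
  apply: nearW => N; apply: cot_psum_lipschitz; lra.
have glip2 n y z : 0 < y <= 1 / 2 -> 0 < z <= 1 / 2 ->
    `|g y - g z| <= L / 2 ^+ n * `|y - z|.
  elim: n y z => [|n IH] y z hy hz; first by rewrite expr0 divr1; exact: glip.
  rewrite (gdup _ hy) (gdup _ hz).
  have -> : (g (y / 2) - g ((1 - y) / 2)) / 2 - (g (z / 2) - g ((1 - z) / 2)) / 2 =
    2^-1 * ((g (y / 2) - g (z / 2)) - (g ((1 - y) / 2) - g ((1 - z) / 2))) by field.
  rewrite normrM ger0_norm ?invr_ge0//.
  have h1 := ler_normB (g (y / 2) - g (z / 2)) (g ((1 - y) / 2) - g ((1 - z) / 2)).
  have h2 : `|g (y / 2) - g (z / 2)| <= L / 2 ^+ n * (`|y - z| / 2).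
    apply: le_trans (IH _ _ _ _) _; [lra|lra|].
    by rewrite -mulrBl normrM (@ger0_norm _ 2^-1).
  have h3 : `|g ((1 - y) / 2) - g ((1 - z) / 2)| <= L / 2 ^+ n * (`|y - z| / 2).
    apply: le_trans (IH _ _ _ _) _; [lra|lra|].
    have -> : (1 - y) / 2 - (1 - z) / 2 = - ((y - z) / 2) by field.
    by rewrite normrN normrM (@ger0_norm _ 2^-1).
  rewrite exprSr invfM [leRHS]mulrC.
  have -> : `|y - z| * (L * ((2 ^+ n)^-1 * 2^-1)) = 2^-1 * (L / 2 ^+ n * (`|y - z| / 2) * 2) by field.
  by rewrite ler_wpM2l ?invr_ge0//; lra.
have gcst y z : 0 < y <= 1 / 2 -> 0 < z <= 1 / 2 -> g y = g z.
  move=> hy hz; apply/eqP; rewrite -subr_eq0 -normr_le0.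
  have h : L / 2 ^+ n * `|y - z| @[n --> \oo] --> (0 : R).
    rewrite -[X in _ --> X](mul0r `|y - z|); apply: cvgMl.
    rewrite -[X in _ --> X](mulr0 L); apply: cvgMr.
    under eq_fun do rewrite -exprVn.
    by apply: cvg_expr; rewrite ger0_norm ?invr_ge0// invf_lt1// ltr1n.
  rewrite -(cvg_lim _ h)//; apply: limr_ge; first by apply/cvg_ex; exists 0.
  by apply: nearW => n; exact: glip2.
have g0 : g x = 0.
  have := gdup _ hx; rewrite (gcst (x / 2) ((1 - x) / 2)) ?subrr ?mul0r//; lra.
by move: g0; rewrite /g => /eqP; rewrite subr_eq0 => /eqP ->.
Qed.

End cotangent_expansion.

(** * The reflection formula for the Beta integral *)

Section beta_reflection.
Variable R : realType.
Implicit Types (x mu : R) (N : nat).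

Lemma cvg_cot_psum x : 0 < x < 1 -> cot_psum N x @[N --> \oo] --> cot x.
Proof.
move=> x01; have [x12|x12] := leP x (1 / 2).
  by apply: cvg_cot_psum_half; rewrite x12 andbT; lra.
have /cvg_cot_psum_half h : 0 < 1 - x <= 1 / 2 by lra.
have y01 : 0 < 1 - x < 1 by lra.
have -> : (fun N => cot_psum N x) = (fun N => - (cot_psum N (1 - x)
    - (x + 1 * N%:R)^-1 - (1 - x + 1 * N%:R)^-1)).
  apply/funext => N; have := cot_psum_reflect N y01; rewrite subKr => ->.
  rewrite !mul1r; congr (- (_ + _ - _)).
  by rewrite -invrN; congr (_^-1); ring.
have -> : cot x = - (cot (1 - x) - 0 - 0) by rewrite !subr0 cot_reflect opprK.
apply: cvgN; apply: cvgB; last exact: cvg_add_natr_inv.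
by apply: cvgB => //; exact: cvg_add_natr_inv.
Qed.

Lemma cvg_csc_psum x : 0 < x < 1 ->
  csc_psum N.*2 x @[N --> \oo] --> pi / sin (pi * x).
Proof.
move=> x01; rewrite -cot_csc//.
under eq_fun do rewrite cot_psum_half//.
have x2 : 0 < x / 2 < 1 by lra.
by apply: cvgB; [exact: cvg_cot_psum|exact: (cvg_double (cvg_cot_psum x01))].
Qed.

(** Both parities are needed: even partial sums bound the half integrals of [half_beta] from below,
    odd ones from above. *)
Lemma cvg_alt_psum x : 0 < x < 1 ->
  alt_psum N.*2 x + alt_psum N.*2 (1 - x) @[N --> \oo] --> pi / sin (pi * x) /\
  alt_psum N.*2.+1 x + alt_psum N.*2.+1 (1 - x) @[N --> \oo] --> pi / sin (pi * x).
Proof.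
move=> x01; have x0 : 0 < x by lra. have x1 : x < 1 by lra.
have h : alt_psum N.*2 x + alt_psum N.*2 (1 - x) @[N --> \oo] --> pi / sin (pi * x).
  have -> : (fun N => alt_psum N.*2 x + alt_psum N.*2 (1 - x)) =
      (fun N => csc_psum N.*2 x - (x + 2 * N%:R)^-1).
    apply/funext => N; rewrite csc_psumE//.
    by rewrite -mul2n exprM sqrrN expr1n expr1n natrM div1r.
  rewrite -[X in _ --> X]subr0.
  by apply: cvgB; [exact: cvg_csc_psum|exact: cvg_add_natr_inv].
split => //.
have -> : (fun N => alt_psum N.*2.+1 x + alt_psum N.*2.+1 (1 - x)) =
    (fun N => alt_psum N.*2 x + alt_psum N.*2 (1 - x) + (x + 2 * N%:R)^-1
      + (1 - x + 2 * N%:R)^-1).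
  apply/funext => N; rewrite /alt_psum !big_nat_recr//= addrACA.
  rewrite -mul2n exprM sqrrN !expr1n natrM !div1r; ring.
have -> : pi / sin (pi * x) = pi / sin (pi * x) + 0 + 0 by rewrite !addr0.
by apply: cvgD; [apply: cvgD => //|]; exact: cvg_add_natr_inv.
Qed.

(* With u = x / (1 - x) the density x^(mu-1) (1-x)^(-mu) dx on ]0, 1/2[ becomes
   u^(mu-1) / (1+u) du on ]0, 1[; [alt_dens] truncates the geometric series. *)
Let odds x := x / (1 - x).

Let alt_dens mu N x := odds x `^ (mu - 1) * (1 - x)^-1 * (1 - (- odds x) ^+ N).

Let alt_prim mu N x := \sum_(0 <= i < N) (-1) ^+ i / (mu + i%:R) * odds x `^ (mu + i%:R).

Let odds_gt0 x : 0 < x < 1 -> 0 < odds x.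
Proof. by move=> x01; rewrite divr_gt0; lra. Qed.

Let is_derive_odds x : 0 < x < 1 -> is_derive x (1 : R) odds ((1 - x) ^- 2).
Proof.
move=> x01; have x1 : 1 - x != 0 by apply: lt0r_neq0; lra.
have d1 : is_derive x (1 : R) (fun y => 1 - y) (-1).
  by apply: is_derive_eq; rewrite add0r mul1r.
have d2 := is_deriveM (is_derive_id x (1 : R))
  (@is_deriveV _ (fun y : R => 1 - y) x (-1) (1 : R) x1 d1).
apply: (is_derive_eq d2); rewrite /GRing.scale/=; field.
exact: x1.
Qed.

Let is_derive_alt_prim mu N x : 0 < mu -> 0 < x < 1 ->
  is_derive x (1 : R) (alt_prim mu N) (alt_dens mu N x).
Proof.
move=> mu0 x01; have x1 : 1 - x != 0 by apply: lt0r_neq0; lra.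
have u0 := odds_gt0 x01.
elim: N => [|N IH].
  rewrite /alt_dens expr0 subrr mulr0.
  have -> : alt_prim mu 0 = cst 0 by apply/funext => y; rewrite /alt_prim big_nil.
  exact: is_derive_cst.
have d1 : is_derive x (1 : R) (fun y => odds y `^ (mu + N%:R))
    ((mu + N%:R) * odds x `^ (mu + N%:R - 1) * (1 - x) ^- 2).
  have h1 := is_derive1_powR (mu + N%:R) u0.
  exact: (@is_derive1_comp _ (fun u => u `^ (mu + N%:R)) odds _ _ _ h1 (is_derive_odds x01)).
have -> : alt_prim mu N.+1 = alt_prim mu N \+
    (fun y => ((-1) ^+ N / (mu + N%:R)) *: (odds y `^ (mu + N%:R))).
  by apply/funext => y; rewrite /alt_prim big_nat_recr.
have d2 := is_deriveD IH (is_deriveZ ((-1) ^+ N / (mu + N%:R)) d1).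
apply: (is_derive_eq d2); rewrite /GRing.scale/= /alt_dens.
have -> : odds x `^ (mu + N%:R - 1) = odds x `^ (mu - 1) * odds x ^+ N.
  rewrite (addrAC mu) (powRD (r := mu - 1)) ?(gt_eqF u0) ?implybT//.
  by rewrite powR_mulrn// ltW.
have mN : mu + N%:R != 0 by rewrite lt0r_neq0// ltr_wpDr.
rewrite !(exprNn (odds x)) !(exprS _ N).
move: (odds x `^ _) (odds x ^+ N) ((-1) ^+ N) => p q e.
rewrite /odds; field.
by rewrite mN x1.
Qed.

Let beta_densE mu x : 0 < x < 1 ->
  x `^ (mu - 1) * (1 - x) `^ (- mu) = odds x `^ (mu - 1) * (1 - x)^-1.
Proof.
move=> x01; have x0 : 0 < x by lra. have x1 : 0 < 1 - x by lra.
rewrite /odds powRM ?invr_ge0 ?ltW// -mulrA; congr (_ * _).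
rewrite -powR_inv1 ?ltW// -powRrM -powRD; last by rewrite (gt_eqF x1) implybT.
by congr (_ `^ _); ring.
Qed.

Let alt_dens_ge0 mu N x : 0 < x < 1 / 2 -> 0 <= alt_dens mu N x.
Proof.
move=> x01; rewrite /alt_dens !mulr_ge0 ?powR_ge0 ?invr_ge0//; first by lra.
rewrite subr_ge0; apply: (le_trans (ler_norm _)).
rewrite normrX normrN ger0_norm; last by rewrite divr_ge0; lra.
by rewrite exprn_ile1// ?divr_ge0 ?ler_pdivrMr; lra.
Qed.

Let continuous_alt_dens mu N x : 0 < x < 1 -> {for x, continuous (alt_dens mu N)}.
Proof.
move=> x01; have x1 : 1 - x != 0 by apply: lt0r_neq0; lra.
have co : {for x, continuous odds}.
  apply: differentiable_continuous; apply/derivable1_diffP.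
  by have [] := is_derive_odds x01.
have cp : {for odds x, continuous (fun u : R => u `^ (mu - 1))}.
  apply: differentiable_continuous; apply/derivable1_diffP.
  by have [] := is_derive1_powR (mu - 1) (odds_gt0 x01).
apply: cvgM; [apply: cvgM|].
- exact: (@continuous_comp _ _ _ odds (fun u : R => u `^ (mu - 1))).
- by apply: cvgV => //; apply: cvgB; [exact: cvg_cst|exact: cvg_id].
- apply: cvgB; first exact: cvg_cst.
  apply: (@continuous_comp _ _ _ odds (fun u : R => (- u) ^+ N)) => //.
  apply: (@continuous_comp _ _ _ (fun u : R => - u) (fun u : R => u ^+ N)).
    exact: opp_continuous.
  exact: exprn_continuous.
Qed.

(** In the variable u each term u^(mu+i-1) integrates to [1 / (mu + i)]: the primitive tends to 0 at
    0 because [mu > 0], and [odds (1 / 2) = 1]. *)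
Let integral_alt_dens mu N : 0 < mu ->
  (\int[lebesgue_measure]_(x in `]0%R, (1 / 2)%R[) (alt_dens mu N x)%:E = (alt_psum N mu)%:E)%E.
Proof.
move=> mu0; rewrite -[alt_psum N mu]subr0.
apply: (@ge0_itvoo_FTC _ _ (alt_prim mu N)).
- lra.
- by move=> x; rewrite in_itv/= => x01; apply: is_derive_alt_prim => //; lra.
- by move=> x; rewrite in_itv/= => x01; apply: continuous_alt_dens; lra.
- by move=> x; rewrite in_itv/= => x01; exact: alt_dens_ge0.
(* The limit of powers at 0 is one-sided, so [odds] has to approach 0 through positive values. *)
- have co : odds x @[x --> 0^'+] --> 0^'+.
    have c0 : odds x @[x --> (0 : R)] --> (0 : R).
      rewrite -[X in _ --> X](mul0r ((1 - 0 : R)^-1)).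
      apply: cvgM; first exact: cvg_id.
      apply: cvgV; first by rewrite subr0 oner_neq0.
      by apply: cvgB; [exact: cvg_cst|exact: cvg_id].
    move=> A /= A0; have {}A0 := c0 _ A0.
    change (\forall x \near (0 : R)^'+, A (odds x)); near=> x.
    have x0 : 0 < x by near: x; exact: nbhs_right_gt.
    have x1 : x < 1 by near: x; exact: nbhs_right_lt.
    have u0 : 0 < odds x by apply: odds_gt0; rewrite x0.
    suff h : 0 < odds x -> A (odds x) by exact: h.
    by near: x; apply: cvg_within; exact: A0.
  elim: N => [|N IH].
    rewrite (_ : alt_prim mu 0 = cst 0); first exact: cvg_cst.
    by apply/funext => y; rewrite /alt_prim big_nil.
  have -> : alt_prim mu N.+1 = (fun y => alt_prim mu N y +
    ((-1) ^+ N / (mu + N%:R)) * (odds y `^ (mu + N%:R))).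
    by apply/funext => y; rewrite /alt_prim big_nat_recr.
  rewrite -[X in _ --> X]addr0; apply: cvgD => //.
  rewrite -[X in _ --> X](mulr0 ((-1) ^+ N / (mu + N%:R))); apply: cvgMr.
  apply: (@cvg_comp _ _ _ odds (fun u => u `^ (mu + N%:R))); first exact: co.
  by apply: powR_cvg0; rewrite ltr_wpDr.
- apply: cvg_at_left_filter.
  have -> : alt_psum N mu = alt_prim mu N (1 / 2).
    rewrite /alt_psum /alt_prim; apply: eq_bigr => i _.
    have -> : odds (1 / 2) = 1 by rewrite /odds; field.
    by rewrite powR1 mulr1.
  have h : 0 < (1 / 2 : R) < 1 by lra.
  have : {for (1 / 2 : R), continuous (alt_prim mu N)}.
    apply: differentiable_continuous; apply/derivable1_diffP.
    by have [] := is_derive_alt_prim N mu0 h.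
  exact.
Unshelve. all: by end_near. Qed.

Lemma ge0_integral_onem (D : set R) (f : R -> \bar R) :
  measurable D -> measurable_fun D f -> (forall x, D x -> (0 <= f x)%E) ->
  (\int[lebesgue_measure]_(x in D) f x =
   \int[lebesgue_measure]_(x in (fun x : R => 1 - x)%R @^-1` D) f (1 - x)%R)%E.
Proof.
move=> mD mf f0.
have mphi : @measurable_fun _ _ (measurableTypeR R) (measurableTypeR R) setT
    (fun x : R => 1 - x).
  apply: continuous_measurable_fun => x.
  by apply: cvgB; [exact: cvg_cst|exact: cvg_id].
rewrite -[RHS](ge0_integral_pushforward mphi lebesgue_measure mD mf);
  last by move=> x /set_mem; exact: f0.
have [nu nuE] := pushforward_measure lebesgue_measure mphi.
rewrite -nuE; apply: eq_measure_integral => //= A mA _.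
apply: lebesgue_measure_unique => //= _ [[x y]] _ <-.
rewrite nuE /pushforward/=.
have -> : (fun x : R => 1 - x) @^-1` `]x, y] = `[1 - y, 1 - x[%classic.
  by apply/seteqP; split => z /=; rewrite !in_itv/=; lra.
rewrite !lebesgue_measure_itv/= !lte_fin ltrD2l ltrN2; case: ifP => // _.
by rewrite -!EFinD; congr EFin; ring.
Qed.

Definition beta_dens mu x : R := x `^ (mu - 1) * (1 - x) `^ (- mu).

Lemma beta_dens_ge0 mu x : 0 <= beta_dens mu x.
Proof. by rewrite mulr_ge0 ?powR_ge0. Qed.

Lemma measurable_beta_dens mu : measurable_fun setT (beta_dens mu).
Proof.
apply: measurable_funM.
  exact: (measurableT_comp (measurable_powR (mu - 1)) (@measurable_id _ _ setT)).
have m1 : measurable_fun setT (fun x : R => 1 - x) by exact: measurable_funB.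
exact: (measurableT_comp (measurable_powR (- mu)) m1).
Qed.

(** The truncation factor is [1 - u ^ (2N) <= 1] or [1 + u ^ (2N+1) >= 1] according to parity. *)
Let half_beta mu N : 0 < mu ->
  ((alt_psum N.*2 mu)%:E <=
    \int[lebesgue_measure]_(x in `]0%R, (1 / 2)%R[) (beta_dens mu x)%:E <=
    (alt_psum N.*2.+1 mu)%:E)%E.
Proof.
move=> mu0; rewrite -!integral_alt_dens//; apply/andP; split;
  apply: ge0_le_integral_nomeas => x /=; rewrite in_itv/= => x01.
- by rewrite lee_fin alt_dens_ge0.
- rewrite lee_fin /beta_dens beta_densE; last by lra.
  rewrite /alt_dens ler_piMr//.
    by rewrite mulr_ge0 ?powR_ge0// invr_ge0; lra.
  by rewrite gerBl -mul2n exprM sqrrN exprn_ge0 ?sqr_ge0.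
- by rewrite lee_fin beta_dens_ge0.
- rewrite lee_fin /beta_dens beta_densE; last by lra.
  rewrite /alt_dens ler_peMr//.
    by rewrite mulr_ge0 ?powR_ge0// invr_ge0; lra.
  rewrite exprS -mul2n exprM sqrrN mulNr opprK lerDl mulr_ge0 ?exprn_ge0 ?sqr_ge0//;
    by apply/ltW/odds_gt0; lra.
Qed.

(** Beyond 1/2, the reflection x -> 1 - x turns the density into the one with parameter [1 - mu] on
    []0, 1/2]]. The two halves together are squeezed between sequences with limit pi / sin(pi mu);
    the bracket at [N = 0] already gives finiteness. *)
Lemma integral_beta_dens mu : 0 < mu < 1 ->
  (\int[lebesgue_measure]_(x in `]0%R, 1%R[) (beta_dens mu x)%:E =
   (pi / sin (pi * mu))%:E)%E.
Proof.
move=> mu01; have mu0 : 0 < mu by lra. have mu1 : 0 < 1 - mu by lra.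
have mb D m : measurable_fun D (fun x : R => (beta_dens m x)%:E).
  by apply/measurable_EFinP; apply: measurable_funTS; exact: measurable_beta_dens.
pose h m := (\int[lebesgue_measure]_(x in `]0%R, (1 / 2)%R[) (beta_dens m x)%:E)%E.
have -> : (\int[lebesgue_measure]_(x in `]0%R, 1%R[) (beta_dens mu x)%:E =
    h mu + h (1 - mu)%R)%E.
  have -> : `]0%R, 1%R[%classic = `]0, 1 / 2[ `|` `[1 / 2, 1[ :> set R.
    apply/seteqP; split => x /=; rewrite !in_itv/=.
      by move=> x01; have [x2|x2] := ltP x (1 / 2); [left|right]; lra.
    by case; lra.
  rewrite ge0_integral_setU//=; last 3 first.
  - exact: mb.
  - by move=> x _; rewrite lee_fin beta_dens_ge0.
  - apply/disj_setPS => x /= []; rewrite !in_itv/=; lra.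
  congr (_ + _)%E.
  rewrite ge0_integral_onem//; last by move=> x _; rewrite lee_fin beta_dens_ge0.
  have -> : (fun x : R => 1 - x) @^-1` `[1 / 2, 1[ = `]0, 1 / 2]%classic.
    by apply/seteqP; split => x /=; rewrite !in_itv/=; lra.
  rewrite -[LHS]integral_itv_bndo_bndc//=; last first.
    apply/measurable_EFinP; apply: measurable_funTS.
    apply: (measurableT_comp (measurable_beta_dens mu)).
    exact: measurable_funB.
  apply: eq_integral => x _; rewrite /beta_dens subKr mulrC opprB.
  by rewrite (addrAC 1) subrr add0r.
have [c1 c2] := cvg_alt_psum mu01.
have hb N : ((alt_psum N.*2 mu + alt_psum N.*2 (1 - mu))%R%:E <= h mu + h (1 - mu)%R <=
    (alt_psum N.*2.+1 mu + alt_psum N.*2.+1 (1 - mu))%R%:E)%E.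
  have /andP[h1 h2] := half_beta N mu0; have /andP[h3 h4] := half_beta N mu1.
  by rewrite !EFinD !leeD.
have hfin : (h mu + h (1 - mu)%R)%E \is a fin_num.
  have /andP[h1 h2] := hb 0%N.
  rewrite fin_numE; apply/andP; split.
    by apply/negP => /eqP e; rewrite e in h1.
  by apply/negP => /eqP e; rewrite e in h2.
rewrite -(fineK hfin); congr EFin.
apply/eqP; rewrite eq_le; apply/andP; split.
  rewrite -(cvg_lim _ c2)//; apply: limr_ge; first by apply/cvg_ex; exists (pi / sin (pi * mu)).
  by apply: nearW => N; have /andP[_] := hb N; rewrite -{1}(fineK hfin) lee_fin.
rewrite -(cvg_lim _ c1)//; apply: limr_le; first by apply/cvg_ex; exists (pi / sin (pi * mu)).
by apply: nearW => N; have /andP[+ _] := hb N; rewrite -{1}(fineK hfin) lee_fin.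
Qed.

End beta_reflection.

(** * First passage decomposition *)

Section paths.
Context {R : realType} {d : measure_display} {T : measurableType d}.
Variables (P : probability T R) (Z : R -> {RV P >-> R}).
Implicit Types (s t u v e : R) (w : T) (A : set T).

Lemma natural_filtration_measurable s A : natural_filtration Z s A -> measurable A.
Proof.
apply: smallest_sub; first exact: sigma_algebra_measurable.
move=> _ [u [U [_ mU ->]]].
by rewrite -[X in measurable X]setTI; exact: (measurable_funPT (Z u)).
Qed.

Lemma natural_filtration_preimage s u (U : set R) : 0 <= u <= s -> measurable U ->
  natural_filtration Z s (Z u @^-1` U).
Proof. by move=> us mU; apply: sub_gen_smallest; exists u, U. Qed.

Lemma natural_filtrationI s A B : natural_filtration Z s A ->
  natural_filtration Z s B -> natural_filtration Z s (A `&` B).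
Proof.
pose G := [set A | exists u (U : set R),
  [/\ 0 <= u <= s, measurable U & A = Z u @^-1` U]].
exact: (@measurableI _ (g_sigma_algebraType G)).
Qed.

Lemma natural_filtrationT s : natural_filtration Z s setT.
Proof.
pose G := [set A | exists u (U : set R),
  [/\ 0 <= u <= s, measurable U & A = Z u @^-1` U]].
exact: (@measurableT _ (g_sigma_algebraType G)).
Qed.

Definition small s e : set T := [set w | `|Z s w| <= e].

Lemma small_preimage s e : small s e = Z s @^-1` `[- e, e].
Proof. by apply/seteqP; split => w; rewrite /small /= in_itv/= ler_norml. Qed.

Lemma natural_filtration_small s u e : 0 <= u <= s ->
  natural_filtration Z s (small u e).
Proof. by move=> us; rewrite small_preimage; exact: natural_filtration_preimage. Qed.

Lemma natural_filtration_smallC s u e : 0 <= u <= s ->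
  natural_filtration Z s (~` small u e).
Proof.
move=> us; rewrite small_preimage preimage_setC.
by apply: natural_filtration_preimage => //; exact: measurableC.
Qed.

Lemma measurable_small s e : measurable (small s e).
Proof.
rewrite small_preimage -[X in measurable X]setTI.
exact: (measurable_funPT (Z s)).
Qed.

Definition first_small e (s : nat -> R) i : set T :=
  [set w | small (s i) e w /\ forall j, (j < i)%N -> ~ small (s j) e w].

(** A first hit at [s i] is decided by the path up to [s i]; this is what makes the Markov property
    at the fixed time [s i] sufficient. *)
Lemma natural_filtration_first_small e (s : nat -> R) i :
  (forall j, (j <= i)%N -> 0 <= s j <= s i) ->
  natural_filtration Z (s i) (first_small e s i).
Proof.
move=> si.
have h k : (k <= i)%N ->
    natural_filtration Z (s i) [set w | forall j, (j < k)%N -> ~ small (s j) e w].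
  elim: k => [_|k IH ki].
    rewrite [X in natural_filtration _ _ X](_ : _ = setT); first exact: natural_filtrationT.
    by apply/seteqP; split.
  rewrite [X in natural_filtration _ _ X](_ : _ =
    [set w | forall j, (j < k)%N -> ~ small (s j) e w] `&` ~` small (s k) e).
    apply: natural_filtrationI; first exact: IH (ltnW ki).
    by apply: natural_filtration_smallC; apply: si; exact: ltnW.
  apply/seteqP; split => w /= hw.
    by split=> [j jk|]; apply: hw => //; exact: ltnW.
  move=> j; rewrite ltnS leq_eqVlt => /predU1P[->|]; first exact: hw.2.
  exact: hw.1.
apply: natural_filtrationI; last exact: h.
by apply: natural_filtration_small; exact: si.
Qed.

Lemma trivIset_first_small e (s : nat -> R) : trivIset setT (first_small e s).
Proof.
apply/trivIsetP => i j _ _; rewrite neq_lt => /orP[] ij; apply/seteqP; split => // w /=.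
  by move=> [[h1 _] [_ h2]]; exact: (h2 i).
by move=> [[_ h2] [h1 _]]; exact: (h2 j).
Qed.

Definition some_small e (s : nat -> R) N : set T :=
  [set w | exists2 i, (i < N)%N & small (s i) e w].

Lemma some_smallE e (s : nat -> R) N :
  some_small e s N = \big[setU/set0]_(i < N) first_small e s i.
Proof.
apply/seteqP; split => [w [i iN wi]|w].
  have ex : exists i, `[< small (s i) e w >] by exists i; apply/asboolP.
  case: (ex_minnP ex) => k /asboolP wk kmin.
  have kN : (k < N)%N by apply: leq_ltn_trans iN; apply: kmin; exact/asboolP.
  rewrite -bigcup_mkord; exists k => //; split => // j jk wj.
  by have := kmin j; rewrite leqNgt jk => /(_ _)/negP; apply => //; exact/asboolP.
by rewrite -bigcup_mkord => -[k /= kN [wk _]]; exists k.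
Qed.

Lemma path_near w : continuous_paths Z -> forall u, 0 <= u -> forall e, 0 < e ->
  exists2 r, 0 < r & forall v, 0 <= v -> `|u - v| < r -> `|Z u w - Z v w| < e.
Proof.
move=> /(_ w)/subspace_continuousP cZ u u0 e e0.
have /cZ/cvgrPdist_lt/(_ e e0)[r /= r0 h] : `[0, +oo[%classic u by rewrite /= in_itv/= u0.
exists r => // v v0 uv; apply: h => //.
by rewrite /= in_itv/= v0.
Qed.

(* Rational times make this event measurable; by continuity they capture the
   jumps between arbitrary times ([jump_real]). *)
Definition jump e e' (n : nat) : set T :=
  [set w | exists q1 q2 : rat, [/\ 0 <= (ratr q1 : R) <= 2, 0 <= (ratr q2 : R) <= 2,
     `|ratr q1 - ratr q2| < n.+1%:R^-1 :> R,
     ~ small (ratr q1) e w & small (ratr q2) e' w]].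

Lemma measurable_jump e e' n : measurable (jump e e' n).
Proof.
rewrite [X in measurable X](_ : _ = \bigcup_q1 \bigcup_q2
    [set w | [/\ 0 <= (ratr q1 : R) <= 2, 0 <= (ratr q2 : R) <= 2,
     `|ratr q1 - ratr q2| < n.+1%:R^-1 :> R,
     ~ small (ratr q1) e w & small (ratr q2) e' w]]); last first.
  apply/seteqP; split => [w [q1 [q2 h]]|w [q1 _ [q2 _ h]]]; last by exists q1, q2.
  by exists q1 => //; exists q2.
apply: bigcupT_measurable_rat => q1; apply: bigcupT_measurable_rat => q2.
have [h|h] := pselect ([/\ 0 <= (ratr q1 : R) <= 2, 0 <= (ratr q2 : R) <= 2 &
   `|ratr q1 - ratr q2| < n.+1%:R^-1 :> R]); last first.
  rewrite [X in measurable X](_ : _ = set0)//.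
  by apply/seteqP; split => // w /= [h1 h2 h3 _ _]; exact: h.
rewrite [X in measurable X](_ : _ = ~` small (ratr q1) e `&` small (ratr q2) e').
  by apply: measurableI; [apply: measurableC|]; exact: measurable_small.
by case: h => h1 h2 h3; apply/seteqP; split => w /= [].
Qed.

(** Both times are moved slightly to the right, to rational ones; the strict inequalities among the
    hypotheses leave the room for it. *)
Lemma jump_real e e' e'' n u v w : continuous_paths Z -> e'' < e' ->
  0 <= u < 2 -> 0 <= v < 2 -> `|u - v| < n.+1%:R^-1 ->
  e < `|Z u w| -> `|Z v w| <= e'' -> jump e e' n w.
Proof.
move=> cZ ee' /andP[u0 u2] /andP[v0 v2] uv hu hv.
have r0 : 0 < n.+1%:R^-1 - `|u - v| by rewrite subr_gt0.
have [r1 r10 h1] : exists2 r, 0 < r & forall v, 0 <= v -> `|u - v| < r -> `|Z u w - Z v w| < `|Z u w| - e.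
  by apply: path_near => //; rewrite subr_gt0.
have [r2 r20 h2] : exists2 r, 0 < r & forall y, 0 <= y -> `|v - y| < r -> `|Z v w - Z y w| < e' - e''.
  by apply: path_near => //; rewrite subr_gt0.
pose m := (n.+1%:R^-1 - `|u - v|) / 2.
have m0 : 0 < m by rewrite divr_gt0.
have [q1 /andP[uq1 q1u]] : exists q : rat, (u < ratr q < u + Num.min (Num.min r1 (2 - u)) m).
  have := @rat_in_itvoo R u (u + Num.min (Num.min r1 (2 - u)) m).
  rewrite ltrDl !lt_min r10 m0 subr_gt0 u2 => /(_ isT)[q].
  by rewrite in_itv/=; exists q.
have [q2 /andP[vq2 q2v]] : exists q : rat, (v < ratr q < v + Num.min (Num.min r2 (2 - v)) m).
  have := @rat_in_itvoo R v (v + Num.min (Num.min r2 (2 - v)) m).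
  rewrite ltrDl !lt_min r20 m0 subr_gt0 v2 => /(_ isT)[q].
  by rewrite in_itv/=; exists q.
move: q1u q2v; rewrite -!ltrBlDl !lt_min => /andP[/andP[a1 a2] a3] /andP[/andP[b1 b2] b3].
exists q1, q2; split.
- by apply/andP; split; lra.
- by apply/andP; split; lra.
- have -> : ratr q1 - ratr q2 = (u - v) + ((ratr q1 - u) - (ratr q2 - v)) :> R by ring.
  apply: (le_lt_trans (ler_normD _ _)); rewrite -ltrBrDl.
  have -> : n.+1%:R^-1 - `|u - v| = 2 * m by rewrite /m; field.
  by rewrite ltr_norml; apply/andP; split; move: a3 b3 uq1 vq2 m0; clearbody m; clear; lra.
- rewrite /small /= => h.
  have := h1 (ratr q1); rewrite distrC gtr0_norm ?subr_gt0//.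
  move=> /(_ (ltW (le_lt_trans u0 uq1)) a1).
  by have := lerB_dist (Z u w) (Z (ratr q1) w); lra.
- rewrite /small /=.
  have := h2 (ratr q2); rewrite distrC gtr0_norm ?subr_gt0//.
  move=> /(_ (ltW (le_lt_trans v0 vq2)) b1).
  by rewrite distrC; have := lerB_dist (Z (ratr q2) w) (Z v w); lra.
Qed.

(* By Heine a path is uniformly continuous on [0, 2], hence in no [jump e e' n]
   for large n. *)
Lemma jump_cvg0 e e' : continuous_paths Z -> e' < e ->
  P (jump e e' n) @[n --> \oo] --> 0%E.
Proof.
move=> cZ ee'.
rewrite (_ : 0%E = P (\bigcap_n jump e e' n)); last first.
  rewrite -[LHS](measure0 P); congr (P _); apply/esym/seteqP; split => // w hw.
  (* Compactness in its near-covering form provides a single [n] valid for all starting times [x] in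
     [[0, 2]]. *)
  pose far n x := forall v, 0 <= x -> 0 <= v <= 2 ->
    `|x - v| < n.+1%:R^-1 -> small x e w \/ ~ small v e' w.
  have /compact_near_coveringP/(_ nat \oo far _)[] : compact `[(0 : R), 2]%classic.
  - exact: segment_compact.
  - move=> x /=; rewrite in_itv/= => /andP[x0 x2].
    have [r r0 hr] : exists2 r, 0 < r & forall v, 0 <= v -> `|x - v| < r ->
        `|Z x w - Z v w| < (e - e') / 2.
      by apply: path_near => //; rewrite divr_gt0 ?subr_gt0.
    exists (ball x (r / 2), [set n | n.+1%:R^-1 < r / 2]) => /=.
      split; first by apply: nbhsx_ballx; rewrite divr_gt0.
      have /cvgrPdist_lt/(_ (r / 2)) := @cvg_harmonic R.
      rewrite divr_gt0// => /(_ isT); apply: filterS => n /=.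
      by rewrite sub0r normrN ger0_norm.
    move=> [y n] /= [xy nr] v y0 /andP[v0 v2] yv.
    have xy' : `|x - y| < r / 2 by exact: xy.
    have yv' : `|y - v| < r / 2 by exact: lt_trans yv nr.
    have h1 : `|Z x w - Z y w| < (e - e') / 2 by apply: hr => //; clear yv nr; lra.
    have h2 : `|Z x w - Z v w| < (e - e') / 2.
      by apply: hr => //; have := ler_distD y x v; clear yv nr; lra.
    have [ye|ey] := leP `|Z y w| e; [by left|right; rewrite /small/= => ve].
    have := lerB_dist (Z y w) (Z v w); have := ler_distD (Z x w) (Z y w) (Z v w).
    rewrite (distrC (Z y w) (Z x w)); lra.
  move=> N _ hN; have [//|q1 [q2 [q1I q2I q12 n1 n2]]] := hw N.
  have := hN N (leqnn N) (ratr q1); rewrite /= in_itv/= => /(_ q1I (ratr q2)).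
  by case/andP: q1I => q10 _ /(_ q10 q2I q12)[].
apply: nonincreasing_cvg_mu.
- by rewrite (le_lt_trans (probability_le1 _ _)) ?ltry//; exact: measurable_jump.
- by move=> n; exact: measurable_jump.
- by apply: bigcapT_measurable => n; exact: measurable_jump.
- move=> m n mn; apply/subsetPset => w [q1 [q2 [h1 h2 h3 h4 h5]]].
  exists q1, q2; split => //; apply: (lt_le_trans h3).
  by rewrite lef_pV2 ?posrE// ler_nat.
Qed.

End paths.

(** * Small ball bounds and the resulting first passage inequalities *)

Section small_balls.
Context {R : realType} {d : measure_display} {T : measurableType d}.
Variables (P : probability T R) (Z : R -> {RV P >-> R}).
Implicit Types (mu C r s a e eta : R) (A : set T).

(* [C * eta `^ (2 - 2 * mu) * (a - s) `^ (mu - 1)] is the probability that a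
   Bessel process of dimension [2 * (1 - mu)] sitting at 0 at time [s] is at
   most [eta] at time [a], to leading order as [eta] tends to 0. *)
Definition small_ball_ge mu C : Prop := forall s a e eta A,
  0 <= s < a -> 0 <= e -> 0 < eta -> natural_filtration Z s A ->
  A `<=` small Z s e ->
  ((C * eta `^ (2 - 2 * mu) * (a - s) `^ (mu - 1)
     * expR (- ((e + eta) ^+ 2 / (2 * (a - s)))))%:E * P A
   <= P (A `&` small Z a eta))%E.

(** No condition is put on the position at time [s]. The restriction on [eta] is the range in which,
    for a Bessel process, the Gaussian factor absorbs the growth of the Bessel function; for
    Brownian motion every [r] is admissible. *)
Definition small_ball_le mu C r : Prop := forall s a eta A,
  0 <= s < a -> 0 < eta -> eta ^+ 2 <= r * (a - s) -> natural_filtration Z s A ->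
  (P (A `&` small Z a eta) <=
   (C * eta `^ (2 - 2 * mu) * (a - s) `^ (mu - 1))%:E * P A)%E.

Let fineP A : measurable A -> P A = (fine (P A))%:E.
Proof. by move=> mA; rewrite fineK// fin_num_measure. Qed.

Section hits.
Variables (mu C r e : R) (s : nat -> R) (N : nat).
Hypotheses (C0 : 0 < C) (e0 : 0 <= e) (s0 : forall i, 0 <= s i).
Hypotheses (s_nd : forall i j, (i <= j)%N -> s i <= s j).
Hypotheses (hge : small_ball_ge mu C) (hle : small_ball_le mu C r).

Let hit i := first_small Z e s i.

Let hit_filtration i : natural_filtration Z (s i) (hit i).
Proof. by apply: natural_filtration_first_small => j ji; rewrite s0 s_nd. Qed.

Let measurable_hit i : measurable (hit i).
Proof. exact: natural_filtration_measurable (@hit_filtration i). Qed.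

Let measurable_hitI i a eta : measurable (hit i `&` small Z a eta).
Proof. by apply: measurableI; last exact: measurable_small. Qed.

Let hit_disjoint a eta (Q : pred nat) :
  P (\big[setU/set0]_(i < N | Q i) (hit i `&` small Z a eta)) =
  (\sum_(i < N | Q i) P (hit i `&` small Z a eta))%E.
Proof.
apply: (@measure_bigsetU_ord _ _ _ _ _ (fun i : 'I_N => Q i)
  (fun i : 'I_N => hit i `&` small Z a eta)) => // i j _ _ [w [[h1 _] [h2 _]]].
have /trivIsetP h := @trivIset_first_small R d T P Z e s.
apply/val_inj/eqP; apply: contraT => ij.
have : (hit i `&` hit j) w by [].
by rewrite h.
Qed.

Let hitsP a eta w :
  (\big[setU/set0]_(i < N | s i < a) (hit i `&` small Z a eta)) w <->
  exists i, [/\ (i < N)%N, s i < a, hit i w & small Z a eta w].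
Proof.
rewrite big_mkcond/= -(bigcup_mkord N (fun i => if s i < a then
  hit i `&` small Z a eta else set0)).
split=> [[i /= iN]|[i [iN sia wi wa]]]; last by exists i => //; rewrite sia.
by case: ifPn => // sia [wi wa]; exists i.
Qed.

(* Split {|Z_a| <= eta} at the first [s i] with |Z_(s i)| <= e: the whole is
   bounded above from time 0 and the pieces below from time [s i], and the other
   way round in [first_hit_lower]. *)
Lemma first_hit_upper a eta : 0 < a -> 0 < eta -> eta ^+ 2 <= r * a ->
  \sum_(i < N | s i < a) (a - s i) `^ (mu - 1)
    * expR (- ((e + eta) ^+ 2 / (2 * (a - s i)))) * fine (P (first_small Z e s i))
  <= a `^ (mu - 1).
Proof.
move=> a0 eta0 etara.
have K0 : 0 < C * eta `^ (2 - 2 * mu) by rewrite mulr_gt0// powR_gt0.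
rewrite -(ler_pM2l K0) -lee_fin.
have /= := @hle 0 a eta setT; rewrite subr0 lexx a0 => /(_ isT eta0 etara).
move=> /(_ (@natural_filtrationT _ _ _ P Z 0)); rewrite setTI probability_setT mule1.
apply: le_trans.
apply: (@le_trans _ _ (P (\big[setU/set0]_(i < N | s i < a) (hit i `&` small Z a eta)))).
  rewrite (hit_disjoint a eta (fun i => s i < a)) mulr_sumr -sumEFin; apply: lee_sum => i sia.
  rewrite !mulrA EFinM -fineP//; apply: hge => //.
  - by rewrite s0.
  - by move=> w [].
apply: le_measure; rewrite ?inE.
- by apply: bigsetU_measurable => i _.
- exact: measurable_small.
- by move=> w /hitsP[i []].
Qed.

(** Two errors appear. Hits so close to [a] that [small_ball_le] does not apply are bounded by their
    own probability, hence the indicator. A path within [eta] of 0 at time [a] without an earlier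
    hit is above [e] at a grid time less than [1 / (n + 1)] before [a], hence lies in [jump]. *)
Lemma first_hit_lower a eta e' n : continuous_paths Z ->
  P [set w | Z 0 w = 0] = 1%E -> 0 < eta < e' -> 0 < a < 2 ->
  (exists i, [/\ (i < N)%N, s i < a & a - s i < n.+1%:R^-1]) ->
  C * eta `^ (2 - 2 * mu) * a `^ (mu - 1) * expR (- (eta ^+ 2 / (2 * a))) <=
  \sum_(i < N | s i < a)
    (C * eta `^ (2 - 2 * mu) * (a - s i) `^ (mu - 1) + (r * (a - s i) < eta ^+ 2)%R%:R)
     * fine (P (first_small Z e s i)) + fine (P (jump Z e e' n)).
Proof.
move=> cZ Z0 /andP[eta0 etae'] /andP[a0 a2] [i0 [i0N si0a asi0]].
have K0 : 0 < C * eta `^ (2 - 2 * mu) by rewrite mulr_gt0// powR_gt0.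
have mJ := @measurable_jump R d T P Z e e' n.
pose U := \big[setU/set0]_(i < N | s i < a) (hit i `&` small Z a eta).
have mU : measurable U by apply: bigsetU_measurable => i _.
rewrite -lee_fin.
have small0 : [set w | Z 0 w = 0] = small Z 0 0.
  by apply/seteqP; split => w; rewrite /small/= normr_le0 => /eqP.
have := @hge 0 a 0 eta (small Z 0 0).
rewrite subr0 lexx a0 => /(_ isT isT eta0).
have f0 : natural_filtration Z 0 (small Z 0 0).
  by apply: natural_filtration_small; rewrite lexx.
move=> /(_ f0 (@subset_refl _ _)).
rewrite -small0 Z0 mule1 add0r => /le_trans; apply.
apply: (@le_trans _ _ (P (U `|` jump Z e e' n))).
  apply: le_measure; rewrite ?inE.
  - rewrite small0; by apply: measurableI; exact: measurable_small.
  - exact: measurableU.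
  move=> w [_ wa].
  have [[i [iN [sia wi]]]|nex] := pselect (exists i, (i < N)%N /\ s i < a /\ hit i w).
    by left; apply/hitsP; exists i.
  right; apply: (jump_real (u := s i0) (v := a) cZ etae') => //.
  - by rewrite s0 (lt_trans si0a).
  - by rewrite (ltW a0).
  - by rewrite distrC gtr0_norm ?subr_gt0.
  rewrite ltNge; apply/negP => wi0; apply: nex.
  have : some_small Z e s i0.+1 w by exists i0.
  rewrite some_smallE -bigcup_mkord => -[i /= ii0 wi].
  exists i; split; first by rewrite (leq_trans ii0).
  by split => //; apply: le_lt_trans si0a; apply: s_nd; rewrite -ltnS.
apply: (le_trans (measureU2 _ _ _)) => //.
rewrite EFinD -fineP//; apply: leeD => //.
apply: (@le_trans _ _ (\sum_(i < N | (s i < a)%R) P (hit i `&` small Z a eta))%E).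
  by have := hit_disjoint a eta (fun i => s i < a) => /= <-.
rewrite -sumEFin; apply: lee_sum => i sia.
rewrite mulrDl; have [small_a|big_a] := ltP (r * (a - s i)) (eta ^+ 2).
  rewrite mul1r EFinD -fineP//; apply: (@le_trans _ _ (P (hit i))).
    by apply: le_measure; rewrite ?inE//; exact: subIsetl.
  by rewrite leeDr// lee_fin mulr_ge0 ?fine_ge0// mulr_ge0 ?powR_ge0// ltW.
rewrite mul0r addr0 EFinM -fineP//; apply: hle => //.
by rewrite s0.
Qed.

Lemma some_small_sum :
  fine (P (some_small Z e s N)) = \sum_(i < N) fine (P (first_small Z e s i)).
Proof.
rewrite some_smallE (measure_bigsetU_ord P xpredT)//.
- rewrite (eq_bigr (fun i : 'I_N => (fine (P (hit i)))%:E)) ?sumEFin// => i _.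
  exact: fineP.
- move=> i j _ _ [w [h1 h2]].
  have /trivIsetP h := @trivIset_first_small R d T P Z e s.
  apply/val_inj/eqP; apply: contraT => ij.
  have : (hit i `&` hit j) w by [].
  by rewrite /hit h.
Qed.

End hits.
End small_balls.

(** * Abel inversion of the first passage inequalities *)

Section integrated_hits.
Context {R : realType} {d : measure_display} {T : measurableType d}.
Variables (P : probability T R) (Z : R -> {RV P >-> R}).
Implicit Types (mu C r s a e eta : R) (A : set T).

Lemma measurable_inv : measurable_fun setT (@GRing.inv R).
Proof.
rewrite -(setUv [set 0]); apply/measurable_funU => //.
  exact: measurableC.
split; first exact: measurable_fun_set1.
apply: open_continuous_measurable_fun.
  by rewrite openC; exact: closed_eq.
by move=> x /set_mem /= /eqP x0; apply: inv_continuous.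
Qed.

(** Abel weight times the small ball kernel started at [s]; [w] stands for [(e + eta) ^ 2 / 2]. *)
Definition shifted_dens mu w s a : R :=
  (1 - a) `^ (- mu) * ((a - s) `^ (mu - 1) * expR (- (w / (a - s)))).

Lemma shifted_dens_ge0 mu w s a : 0 <= shifted_dens mu w s a.
Proof. by rewrite !mulr_ge0 ?powR_ge0 ?expR_ge0. Qed.

Lemma measurable_shifted_dens mu w s : measurable_fun setT (shifted_dens mu w s).
Proof.
have mB : measurable_fun setT (fun a : R => a - s) by exact: measurable_funB.
have mC : measurable_fun setT (fun a : R => 1 - a) by exact: measurable_funB.
apply: measurable_funM; first exact: (measurableT_comp (measurable_powR (- mu)) mC).
apply: measurable_funM; first exact: (measurableT_comp (measurable_powR (mu - 1)) mB).
apply: measurableT_comp; first exact: measurable_expR.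
apply: measurable_funN; apply: measurable_funM; first exact: measurable_cst.
exact: (measurableT_comp measurable_inv mB).
Qed.

(* Integrating (a - s)^(mu-1) against (1 - a)^(-mu) gives a value independent of
   s (Abel's inversion), so that summing over the first passage times leaves
   only the probability of a passage; the factor exp(-w/x) is the correction
   due to the small ball estimates, and disappears as w tends to 0. *)
Definition damped_beta mu w : \bar R :=
  (\int[lebesgue_measure]_(x in `]0%R, 1%R[) (beta_dens mu x * expR (- (w / x)))%:E)%E.

(** Substitute [a = s + (1 - s) * x]: the exponents of [1 - s], namely [1] from the Jacobian, [- mu]
    and [mu - 1], add up to 0. *)
Lemma integral_shifted_dens mu w s : s < 1 ->
  (\int[lebesgue_measure]_(a in `]s, 1%R[) (shifted_dens mu w s a)%:E =
   damped_beta mu (w / (1 - s)%R))%E.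
Proof.
move=> s1; have k0 : 0 < 1 - s by rewrite subr_gt0.
rewrite (ge0_integral_affine s k0)//; last 2 first.
- apply/measurable_EFinP; apply: measurable_funTS; exact: measurable_shifted_dens.
- by move=> x _; rewrite lee_fin shifted_dens_ge0.
have -> : (fun x : R => s + (1 - s) * x) @^-1` `]s, 1[ = `]0, 1[%classic.
  apply/seteqP; split => x /=; rewrite !in_itv/= => /andP[h1 h2]; apply/andP; split; nra.
rewrite -ge0_integralZl_EFin//; last 3 first.
- by move=> x _; rewrite lee_fin shifted_dens_ge0.
- apply/measurable_EFinP; apply: measurable_funTS.
  apply: (measurableT_comp (measurable_shifted_dens mu w s)).
  by apply: measurable_funD => //; exact: measurable_funM.
- exact: ltW.
apply: eq_integral => x /set_mem/=; rewrite in_itv/= => /andP[x0 x1].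
rewrite -EFinM; congr EFin; rewrite /shifted_dens /beta_dens.
have -> : 1 - (s + (1 - s) * x) = (1 - s) * (1 - x) by ring.
rewrite (addrC s) addrK !powRM ?subr_ge0 ?(ltW k0) ?(ltW x0) ?(ltW x1) ?(ltW s1)//.
have -> : w / (1 - s) / x = w / ((1 - s) * x) by rewrite invfM mulrA.
have e : (1 - s) * (1 - s) `^ (- mu) * (1 - s) `^ (mu - 1) = 1.
  rewrite -{1}(powRr1 (ltW k0)) -!powRD ?(gt_eqF k0) ?implybT//.
  have -> : 1 - mu + (mu - 1) = 0 by ring.
  exact: powRr0.
rewrite -[RHS]mul1r -[X in _ = X * _]e; ring.
Qed.

Lemma damped_beta_ge0 mu w : (0 <= damped_beta mu w)%E.
Proof.
by apply: integral_ge0 => x _; rewrite lee_fin mulr_ge0 ?expR_ge0 ?beta_dens_ge0.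
Qed.

Lemma damped_beta_le mu w w' : w <= w' -> (damped_beta mu w' <= damped_beta mu w)%E.
Proof.
move=> ww'; apply: ge0_le_integral_nomeas => x /=; rewrite in_itv/= => /andP[x0 x1].
  by rewrite lee_fin mulr_ge0 ?expR_ge0 ?beta_dens_ge0.
by rewrite lee_fin ler_wpM2l ?beta_dens_ge0// ler_expR lerN2 ler_pM2r ?invr_gt0.
Qed.

Lemma damped_beta0 mu :
  damped_beta mu 0 = (\int[lebesgue_measure]_(x in `]0%R, 1%R[) (beta_dens mu x)%:E)%E.
Proof. by apply: eq_integral => x _; rewrite mul0r oppr0 expR0 mulr1. Qed.

Let mshift mu w s (D : set R) :
  measurable_fun D (fun a : R => (shifted_dens mu w s a)%:E).
Proof.
by apply/measurable_EFinP; apply: measurable_funTS; exact: measurable_shifted_dens.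
Qed.

Let mshiftr mu w s (D : set R) : measurable D ->
  measurable_fun D ((fun a : R => (shifted_dens mu w s a)%:E) \_ `]s, +oo[).
Proof.
by move=> mD; apply: measurable_funTS; apply/(measurable_restrictT _ _).1.
Qed.

Let shiftr_ge0 mu w s a :
  (0 <= ((fun a : R => (shifted_dens mu w s a)%:E) \_ `]s, +oo[) a)%E.
Proof. by apply: erestrict_ge0 => x _; rewrite lee_fin shifted_dens_ge0. Qed.

(** Keeping the hits in [[t, b]] with [b < 1] bounds every damping parameter [w / (1 - s i)] by
    [w / (1 - b)], so that one factor serves all of them. *)
Lemma integrated_hit_upper mu C r e (s : nat -> R) N t b eta :
  0 < C -> 0 <= e -> 0 < t -> b < 1 -> (forall i, t <= s i) -> (forall i, (i < N)%N -> s i <= b) ->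
  (forall i j, (i <= j)%N -> s i <= s j) ->
  small_ball_ge Z mu C -> small_ball_le Z mu C r ->
  0 < eta -> eta ^+ 2 <= r * t -> 0 < r ->
  (P (some_small Z e s N) * damped_beta mu ((e + eta) ^+ 2 / 2 / (1 - b))%R <=
   \int[lebesgue_measure]_(a in `]t, 1%R[) (beta_dens mu a)%:E)%E.
Proof.
move=> C0 e0 t0 b1 ts sb s_nd hge hle eta0 etar r0.
have s0 i : 0 <= s i by exact: le_trans (ltW t0) (ts i).
pose w : R := (e + eta) ^+ 2 / 2.
pose p i := fine (P (first_small Z e s i)).
have p0 i : 0 <= p i by rewrite fine_ge0.
have -> : P (some_small Z e s N) = (\sum_(i < N) p i)%:E.
  rewrite -(some_small_sum Z e N s0 s_nd) fineK//; apply: fin_num_measure.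
  rewrite some_smallE; apply: bigsetU_measurable => i _.
  apply: (@natural_filtration_measurable _ _ _ _ _ (s i)).
  by apply: natural_filtration_first_small => j ji; rewrite s0 s_nd.
(* The condition [s i < a] is moved into the integrand as a restriction, so that sum and integral
   can be exchanged. *)
pose g i (a : R) : \bar R := ((p i)%:E * ((fun a : R => (shifted_dens mu w (s i) a)%:E) \_ `]s i, +oo[) a)%E.
apply: (@le_trans _ _ (\int[lebesgue_measure]_(a in `]t, 1%R[) \sum_(i < N) g i a)%E).
  rewrite ge0_integral_sum//; last 2 first.
  - by move=> i; apply: measurable_funeM; exact: mshiftr.
  - by move=> i a _; rewrite /g mule_ge0 ?lee_fin.
  rewrite -sumEFin ge0_sume_distrl; last by move=> i _; rewrite lee_fin.
  apply: lee_sum => i _; rewrite ge0_integralZl_EFin//; last exact: mshiftr.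
  apply: lee_wpmul2l; first by rewrite lee_fin.
  rewrite -integral_mkcondr.
  have ti := ts i; have ib := sb i (ltn_ord i); have si1 : s i < 1 by exact: le_lt_trans b1.
  have -> : `]t, 1[ `&` `]s i, +oo[ = `]s i, 1[%classic :> set R.
    apply/seteqP; split => x /=; rewrite !in_itv/= ?andbT.
      by move=> [/andP[_ ->] ->].
    by move=> /andP[h1 ->]; rewrite h1 (le_lt_trans ti).
  rewrite integral_shifted_dens//; apply: damped_beta_le.
  rewrite ler_wpM2l ?divr_ge0 ?sqr_ge0// lef_pV2 ?posrE ?subr_gt0//.
  by rewrite lerD2l lerN2.
apply: ge0_le_integral_nomeas => a /=; rewrite in_itv/= => /andP[ta a1].
  by apply: sume_ge0 => i _; rewrite mule_ge0// lee_fin.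
have a0 : 0 < a by exact: lt_trans ta.
have etara : eta ^+ 2 <= r * a by rewrite (le_trans etar)// ler_pM2l// ltW.
have := first_hit_upper N C0 e0 s0 s_nd hge hle a0 eta0 etara.
move=> /(ler_wpM2l (powR_ge0 (1 - a) (- mu))).
rewrite [leRHS]mulrC -lee_fin; apply: le_trans.
rewrite mulr_sumr [X in (_ <= X%:E)%E]big_mkcond/= -sumEFin; apply: lee_sum => i _.
rewrite /g patchE mem_setE in_itv/= andbT; case: ifPn => _; last by rewrite mule0.
have -> : (e + eta) ^+ 2 / (2 * (a - s i)) = w / (a - s i) by rewrite /w invfM mulrA.
rewrite -EFinM lee_fin /shifted_dens /p le_eqVlt; apply/orP; left; apply/eqP; ring.
Qed.

(** The errors come without the kernel, and the cut-off at [1 - k] bounds their weight by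
    [k ^ (- mu)]. The first one then integrates to at most [eta ^ 2 / r] per hit, with hit
    probabilities of sum at most 1; the second lives on an interval of length at most 1. *)
Lemma integrated_hit_lower mu C r e e' (s : nat -> R) N n t eta k :
  0 < mu -> 0 < C -> 0 < t -> 0 < k -> (forall i, t <= s i) ->
  (forall i, (i < N)%N -> s i < 1) ->
  (forall i j, (i <= j)%N -> s i <= s j) ->
  (forall a, t < a < 1 -> exists i, [/\ (i < N)%N, s i < a & a - s i < n.+1%:R^-1]) ->
  small_ball_ge Z mu C -> small_ball_le Z mu C r -> continuous_paths Z ->
  P [set w | Z 0 w = 0] = 1%E ->
  0 < eta < e' -> 0 < r ->
  ((C * eta `^ (2 - 2 * mu) * expR (- (eta ^+ 2 / (2 * t))))%:E *
   \int[lebesgue_measure]_(a in `]t, (1 - k)%R[) (beta_dens mu a)%:E <=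
   (C * eta `^ (2 - 2 * mu))%:E * (P (some_small Z e s N) * damped_beta mu 0) +
   (k `^ (- mu) * (eta ^+ 2 / r))%:E + (k `^ (- mu))%:E * P (jump Z e e' n))%E.
Proof.
move=> mu0 C0 t0 k0 ts s1 s_nd cover hge hle cZ Z0 /[dup] /andP[eta0 _] etae' r0.
have s0 i : 0 <= s i by exact: le_trans (ltW t0) (ts i).
set K := C * eta `^ (2 - 2 * mu).
have K0 : 0 < K by rewrite mulr_gt0// powR_gt0.
pose p i := fine (P (first_small Z e s i)).
have p0 i : 0 <= p i by rewrite fine_ge0.
have mhit i : measurable (first_small Z e s i).
  apply: (@natural_filtration_measurable _ _ _ _ _ (s i)).
  by apply: natural_filtration_first_small => j ji; rewrite s0 s_nd.
have Psum : P (some_small Z e s N) = (\sum_(i < N) p i)%:E.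
  rewrite -(some_small_sum Z e N s0 s_nd) fineK//; apply: fin_num_measure.
  by rewrite some_smallE; apply: bigsetU_measurable => i _.
have p1 : \sum_(i < N) p i <= 1.
  by rewrite -lee_fin -Psum probability_le1// some_smallE; apply: bigsetU_measurable => i _.
pose pJ := fine (P (jump Z e e' n)).
have pJ0 : 0 <= pJ by rewrite fine_ge0.
have PJ : P (jump Z e e' n) = pJ%:E by rewrite fineK// fin_num_measure//; exact: measurable_jump.
pose g i (a : R) : \bar R := ((K * p i)%:E * ((fun a : R => (shifted_dens mu 0 (s i) a)%:E) \_ `]s i, +oo[) a)%E.
(* The condition [r * (a - s i) < eta ^ 2] confines [a] to an interval of length [eta ^ 2 / r]. *)
pose q i (a : R) : \bar R := ((k `^ (- mu) * p i)%:E * (\1_(`]s i, (s i + eta ^+ 2 / r)[%classic) a)%:E)%E.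
pose D : set R := `]t, (1 - k)[%classic.
have mD : measurable D by exact: measurable_itv.
have mg i : measurable_fun D (g i) by apply: measurable_funeM; exact: mshiftr.
have mq i : measurable_fun D (q i).
  apply: measurable_funeM; apply/measurable_EFinP; apply: measurable_funTS.
  exact: measurable_indic.
have g0 i a : (0 <= g i a)%E by apply: mule_ge0 => //; rewrite lee_fin; apply: mulr_ge0 => //; exact: ltW.
have q0 i a : (0 <= q i a)%E by apply: mule_ge0 => //; rewrite lee_fin// mulr_ge0// powR_ge0.
rewrite -ge0_integralZl_EFin//; last 3 first.
- by move=> a _; rewrite lee_fin beta_dens_ge0.
- by apply/measurable_EFinP; apply: measurable_funTS; exact: measurable_beta_dens.
- by rewrite mulr_ge0 ?expR_ge0// ltW.
apply: (@le_trans _ _ (\int[lebesgue_measure]_(a in D)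
  (\sum_(i < N) g i a + \sum_(i < N) q i a + (k `^ (- mu) * pJ)%:E))%E).
  apply: ge0_le_integral_nomeas => a /=; rewrite in_itv/= => /andP[ta a1].
    apply: mule_ge0; rewrite lee_fin ?beta_dens_ge0//.
    by apply: mulr_ge0; [exact: ltW|exact: expR_ge0].
  have a01 : t < a < 1 by rewrite ta (lt_trans a1)// ltrBlDr ltrDl.
  have a02 : 0 < a < 2 by case/andP: a01 => h1 h2; apply/andP; split; lra.
  have a0 : 0 < a by case/andP: a02.
  have := first_hit_lower e C0 s0 s_nd hge hle cZ Z0 etae' a02 (cover _ a01).
  pose m := (1 - a) `^ (- mu).
  have m0 : 0 <= m by exact: powR_ge0.
  have mk : m <= k `^ (- mu).
    have k1a : k <= 1 - a by lra.
    have a10 : 0 < 1 - a by exact: lt_le_trans k1a.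
    rewrite /m !powRN lef_pV2 ?posrE ?powR_gt0//.
    by apply: ge0_ler_powR; rewrite ?nnegrE ?(ltW mu0) ?(ltW k0) ?(ltW a10).
  move=> /(ler_wpM2l m0); rewrite mulrDr => H.
  rewrite -big_split/= -EFinM.
  apply: (@le_trans _ _ (m * (K * a `^ (mu - 1) * expR (- (eta ^+ 2 / (2 * a)))))%:E).
    rewrite lee_fin.
    have -> : m * (K * a `^ (mu - 1) * expR (- (eta ^+ 2 / (2 * a)))) =
        K * expR (- (eta ^+ 2 / (2 * a))) * beta_dens mu a.
      by rewrite /beta_dens -/m; ring.
    apply: ler_wpM2r; first exact: beta_dens_ge0.
    rewrite ler_pM2l// ler_expR lerN2 ler_wpM2l ?sqr_ge0// lef_pV2 ?posrE ?mulr_gt0//.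
    by rewrite ler_pM2l// ltW.
  move: H; rewrite -lee_fin => /le_trans; apply.
  rewrite EFinD; apply: leeD; last by rewrite lee_fin ler_wpM2r.
  rewrite mulr_sumr [X in (X%:E <= _)%E]big_mkcond/= -sumEFin; apply: lee_sum => i _.
  case: ifPn => sia; last by rewrite adde_ge0.
  rewrite mulrDl mulrDr EFinD; apply: leeD.
    rewrite /g patchE mem_setE in_itv/= andbT sia -EFinM lee_fin.
    rewrite /shifted_dens mul0r oppr0 expR0 -/m -/K -/(p i) le_eqVlt.
    by apply/orP; left; apply/eqP; ring.
  have [rs|rs] := boolP (r * (a - s i) < eta ^+ 2); last by rewrite mul0r mulr0.
  rewrite /q indicE mem_setE in_itv/= sia -ltrBlDl ltr_pdivlMr// (mulrC _ r) rs.
  rewrite mule1 lee_fin mul1r; apply: ler_wpM2r mk; exact: p0.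
have sg0 a : (0 <= \sum_(i < N) g i a)%E by apply: sume_ge0 => i _; exact: g0.
have sq0 a : (0 <= \sum_(i < N) q i a)%E by apply: sume_ge0 => i _; exact: q0.
have msg : measurable_fun D (fun a => \sum_(i < N) g i a)%E.
  by apply: emeasurable_sum => i; exact: mg.
have msq : measurable_fun D (fun a => \sum_(i < N) q i a)%E.
  by apply: emeasurable_sum => i; exact: mq.
rewrite ge0_integralD//; last 3 first.
- by move=> a _; exact: adde_ge0.
- exact: emeasurable_funD.
- by move=> a _; rewrite lee_fin mulr_ge0 ?powR_ge0.
rewrite ge0_integralD//.
rewrite PJ; apply: leeD; first apply: leeD.
- rewrite ge0_integral_sum//; last first.
    by move=> i; exact: mg.
  rewrite Psum -sumEFin ge0_sume_distrl//; last by move=> i _; rewrite lee_fin.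
  rewrite ge0_sume_distrr; last by move=> i _; rewrite mule_ge0 ?lee_fin ?damped_beta_ge0.
  apply: lee_sum => i _; rewrite ge0_integralZl_EFin//; last 2 first.
  + exact: mshiftr.
  + by rewrite mulr_ge0// ltW.
  rewrite muleA -EFinM; apply: lee_wpmul2l; first by rewrite lee_fin mulr_ge0// ltW.
  have si1 := s1 i (ltn_ord i).
  rewrite -integral_mkcondr [leRHS](_ : _ = damped_beta mu (0 / (1 - s i))); last by rewrite mul0r.
  rewrite -integral_shifted_dens//; apply: ge0_subset_integral => //.
  + by apply: measurableI.
  + exact: mshift.
  + by move=> a _; rewrite lee_fin shifted_dens_ge0.
  + by move=> a /=; rewrite !in_itv/= ?andbT => -[/andP[_ h1] ->]/=; apply: (lt_trans h1); rewrite ltrBlDr ltrDl.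
- rewrite ge0_integral_sum//; last by move=> i; exact: mq.
  apply: (@le_trans _ _ (\sum_(i < N) (k `^ (- mu) * p i * (eta ^+ 2 / r))%:E)%E).
    apply: lee_sum => i _; rewrite ge0_integralZl_EFin//; last 2 first.
    + by apply/measurable_EFinP; apply: measurable_funTS; exact: measurable_indic.
    + by rewrite mulr_ge0 ?powR_ge0.
    rewrite integral_indic// [leRHS]EFinM; apply: lee_wpmul2l.
      by rewrite lee_fin mulr_ge0 ?powR_ge0.
    apply: (@le_trans _ _ (lebesgue_measure (`]s i, (s i + eta ^+ 2 / r)[%classic : set R))).
      by apply: le_measure; rewrite ?inE//; exact: measurableI.
    rewrite lebesgue_measure_itv/= lte_fin ltrDl divr_gt0 ?exprn_gt0//.
    by rewrite -EFinD addrAC subrr add0r.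
  rewrite sumEFin lee_fin -mulr_suml -mulr_sumr -mulrA (mulrC (\sum_(i < N) _)).
  by rewrite ler_wpM2l ?powR_ge0// ler_piMr// divr_ge0 ?sqr_ge0// ltW.
- rewrite integral_cst// EFinM -[leRHS]mule1; apply: lee_wpmul2l.
    by rewrite -EFinM lee_fin mulr_ge0 ?powR_ge0.
  rewrite /D/= lebesgue_measure_itv/=; case: ifP => // _.
  by rewrite -EFinD lee_fin; lra.
Qed.

End integrated_hits.

(** * From grids to the zeros of continuous paths *)

Section zeros.
Context {R : realType} {d : measure_display} {T : measurableType d}.
Variables (P : probability T R) (Z : R -> {RV P >-> R}).
Implicit Types (mu C r a e eta t b : R) (A : set T).

(** Dyadic, so that each grid contains the previous one and the events [some_small] increase with
    [n]. *)
Definition grid t b n (i : nat) : R := t + i%:R * ((b - t) / 2 ^+ n).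

Lemma grid_nd t b n i j : t <= b -> (i <= j)%N -> grid t b n i <= grid t b n j.
Proof.
move=> tb ij; rewrite lerD2l ler_wpM2r ?ler_nat//.
by rewrite divr_ge0 ?exprn_ge0 ?subr_ge0.
Qed.

Lemma grid0 t b n : grid t b n 0 = t.
Proof. by rewrite /grid mul0r addr0. Qed.

Lemma grid_last t b n : grid t b n (2 ^ n) = b.
Proof.
rewrite /grid natrX mulrC divfK ?expf_neq0 ?pnatr_eq0//.
by rewrite addrC subrK.
Qed.

Lemma grid_lt t b n i : t < b -> (i < 2 ^ n)%N -> grid t b n i < b.
Proof.
move=> tb i2; rewrite -[ltRHS](grid_last t b n) /grid ltrD2l ltr_pM2r ?ltr_nat//.
by rewrite divr_gt0 ?exprn_gt0 ?subr_gt0.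
Qed.

Lemma grid_double t b n i : grid t b n.+1 i.*2 = grid t b n i.
Proof.
rewrite /grid -mul2n natrM exprS invfM; congr (_ + _).
by have := expf_neq0 n (lt0r_neq0 (ltr0n _ 2) : (2 : R) != 0) => h; field.
Qed.

Lemma grid_cover t b n a : t < a <= b ->
  exists i, [/\ (i < 2 ^ n)%N, grid t b n i < a & a - grid t b n i <= (b - t) / 2 ^+ n].
Proof.
move=> /andP[ta ab].
have ex : exists i, a <= grid t b n i by exists (2 ^ n)%N; rewrite grid_last.
case: (ex_minnP ex) => -[|k] ak kmin; first by rewrite grid0 leNgt ta in ak.
exists k; split.
- by rewrite ltnNge; apply/negP => h; have := kmin (2 ^ n)%N; rewrite grid_last => /(_ ab) h';
    have := leq_trans h' h; rewrite ltnn.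
- by rewrite ltNge; apply/negP => /kmin; rewrite ltnn.
- by move: ak; rewrite /grid -natr1 mulrDl mul1r addrA lerBlDl.
Qed.

Lemma natrS_lt_exprn n : n.+1%:R <= 2 ^+ n :> R.
Proof. by rewrite -natrX ler_nat ltn_expl. Qed.

Definition near_zero e t b : set T :=
  \bigcup_n some_small Z e (grid t b n) (2 ^ n).+1.

Definition zero_in t b : set T := [set w | exists2 s, t <= s <= b & Z s w = 0].

Lemma measurable_some_small e (s : nat -> R) N : measurable (some_small Z e s N).
Proof.
rewrite (_ : some_small _ _ _ _ = \bigcup_(i < N) small Z (s i) e).
  by apply: bigcup_measurable => i _; exact: measurable_small.
by apply/seteqP; split=> w [i iN wi]; exists i.
Qed.

Lemma measurable_near_zero e t b : measurable (near_zero e t b).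
Proof. by apply: bigcupT_measurable => n; exact: measurable_some_small. Qed.

Lemma some_small_grid_nd e t b :
  nondecreasing_seq (fun n => some_small Z e (grid t b n) (2 ^ n).+1).
Proof.
apply/nondecreasing_seqP => n; apply/subsetPset => w [i iN wi].
exists i.*2; last by rewrite grid_double.
by rewrite ltnS expnS mul2n leq_double -ltnS.
Qed.

Lemma cvg_some_small e t b :
  P (some_small Z e (grid t b n) (2 ^ n).+1) @[n --> \oo] --> P (near_zero e t b).
Proof.
apply: (nondecreasing_cvg_mu (F := fun n => some_small Z e (grid t b n) (2 ^ n).+1)).
- by move=> n; exact: measurable_some_small.
- exact: measurable_near_zero.
- exact: some_small_grid_nd.
Qed.

Hypothesis cZ : continuous_paths Z.

Lemma sub_near_zero e t b : 0 <= t < b -> 0 < e -> zero_in t b `<=` near_zero e t b.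
Proof.
move=> /andP[t0 tb] e0 w [u /andP[tu ub] Zu].
move: tu; rewrite le_eqVlt => /predU1P[tu|tu].
  by exists 0%N => //; exists 0%N => //; rewrite grid0 tu /small/= Zu normr0 ltW.
have u0 : 0 <= u by rewrite (le_trans t0)// ltW.
have [r r0 hr] := path_near w cZ u0 e0.
have [n nr] : exists n : nat, (b - t) / r < n%:R.
  have := @nbhs_infty_gtr R ((b - t) / r) => -[n _ /(_ n (leqnn n))].
  by exists n.
have /(grid_cover n)[i [i2 iu ui]] : t < u <= b by rewrite tu.
exists n => //; exists i; first by rewrite ltnS ltnW.
have gi0 : 0 <= grid t b n i.
  by rewrite (le_trans t0)// -{1}(grid0 t b n) grid_nd// ltW.
have := hr _ gi0; rewrite Zu sub0r normrN gtr0_norm ?subr_gt0// => h.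
apply/ltW/h; apply: (le_lt_trans ui).
rewrite ltr_pdivrMr ?exprn_gt0// mulrC -ltr_pdivrMr//.
apply: (lt_le_trans nr); apply: le_trans (natrS_lt_exprn n).
by rewrite ler_nat.
Qed.

(** The minimum of |Z| over the compact [[t, b]] is attained and is below every [1 / (k + 1)]. *)
Lemma near_zero_sub t b : 0 <= t < b ->
  \bigcap_k near_zero (k.+1%:R^-1) t b `<=` zero_in t b.
Proof.
move=> /andP[t0 tb] w hw.
have [|c ctb cmin] := @EVT_min R (fun u => `|Z u w|) t b (ltW tb).
  have sub : `[t, b]%classic `<=` `[0, +oo[%classic.
    by move=> x /=; rewrite !in_itv/= andbT => /andP[/(le_trans t0)].
  apply: (continuous_subspaceW sub) => x; apply: cvg_norm; exact: cZ.
exists c; first by move: ctb; rewrite in_itv.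
apply/eqP; rewrite -normr_le0.
have h k : `|Z c w| <= k.+1%:R^-1.
  have [//|n _ [i iN wi]] := hw k.
  apply: le_trans wi; apply: cmin; rewrite in_itv/=.
  rewrite -{1}(grid0 t b n) grid_nd ?(ltW tb)//=.
  by rewrite -[leRHS](grid_last t b n) grid_nd ?(ltW tb)// -ltnS.
have h0 : k.+1%:R^-1 @[k --> \oo] --> (0 : R) by exact: cvg_harmonic.
rewrite -(cvg_lim _ h0)//; apply: limr_ge; first by apply/cvg_ex; exists 0.
by apply: nearW => k; exact: h.
Qed.

Lemma zero_inE t b : 0 <= t < b ->
  zero_in t b = \bigcap_k near_zero (k.+1%:R^-1) t b.
Proof.
move=> tb; apply/seteqP; split; last exact: near_zero_sub.
by move=> w hw k _; apply: sub_near_zero hw.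
Qed.

Lemma measurable_zero_in t b : 0 <= t < b -> measurable (zero_in t b).
Proof.
move=> tb; rewrite zero_inE//; apply: bigcapT_measurable => k.
exact: measurable_near_zero.
Qed.

Lemma cvg_near_zero t b : 0 <= t < b ->
  P (near_zero (k.+1%:R^-1) t b) @[k --> \oo] --> P (zero_in t b).
Proof.
move=> tb; rewrite zero_inE//.
apply: (nonincreasing_cvg_mu (F := fun k => near_zero (k.+1%:R^-1) t b)).
- by rewrite (le_lt_trans (probability_le1 _ _)) ?ltry//; exact: measurable_near_zero.
- by move=> k; exact: measurable_near_zero.
- by apply: bigcapT_measurable => k; exact: measurable_near_zero.
- move=> m n mn; apply/subsetPset => w [k _ [i iN wi]].
  exists k => //; exists i => //; apply: (le_trans wi).
  by rewrite lef_pV2 ?posrE// ler_nat.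
Qed.

Lemma cvg_damped_beta mu : damped_beta mu (k.+1%:R^-1) @[k --> \oo] --> damped_beta mu 0.
Proof.
rewrite damped_beta0.
pose g (k : nat) (x : R) := (beta_dens mu x * expR (- (k.+1%:R^-1 / x)))%:E.
have mg k : measurable_fun (`]0, 1[%classic : set R) (g k).
  apply/measurable_EFinP; apply: measurable_funTS; apply: measurable_funM.
    exact: measurable_beta_dens.
  apply: measurableT_comp; first exact: measurable_expR.
  apply: measurable_funN; apply: measurable_funM; first exact: measurable_cst.
  exact: measurable_inv.
have gE (x : R) : `]0%R, 1%R[%classic x -> limn (g ^~ x) = (beta_dens mu x)%:E.
  move=> _; apply/cvg_lim => //; apply: cvg_EFin; first exact: nearW.
  have -> : beta_dens mu x = beta_dens mu x * expR (- (0 / x)).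
    by rewrite mul0r oppr0 expR0 mulr1.
  apply: cvgMr; apply: continuous_cvg; first exact: continuous_expR.
  by apply: cvgN; apply: cvgMl; exact: cvg_harmonic.
have -> : (\int[lebesgue_measure]_(x in `]0%R, 1%R[) (beta_dens mu x)%:E =
    \int[lebesgue_measure]_(x in `]0%R, 1%R[) limn (g ^~ x))%E.
  by apply: eq_integral => x /set_mem /gE.
apply: cvg_monotone_convergence => //.
- by move=> k x _; rewrite lee_fin mulr_ge0 ?beta_dens_ge0 ?expR_ge0.
- move=> x /=; rewrite in_itv/= => /andP[x0 _] m n mn.
  rewrite lee_fin ler_wpM2l ?beta_dens_ge0// ler_expR lerN2 ler_pM2r ?invr_gt0//.
  by rewrite lef_pV2 ?posrE// ler_nat.
Qed.

Variables (mu C r : R).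
Hypotheses (mu01 : 0 < mu < 1) (C0 : 0 < C) (r0 : 0 < r).
Hypotheses (hge : small_ball_ge Z mu C) (hle : small_ball_le Z mu C r).
Hypothesis Z0 : P [set w | Z 0 w = 0] = 1%E.

Let K t b : \bar R := (\int[lebesgue_measure]_(a in `]t, b[) (beta_dens mu a)%:E)%E.

Let B := damped_beta mu 0.

Let BE : B = (pi / sin (pi * mu))%:E.
Proof. by rewrite /B damped_beta0 integral_beta_dens. Qed.

Let damped_fin w : 0 <= w -> damped_beta mu w \is a fin_num.
Proof.
move=> w0; rewrite ge0_fin_numE ?damped_beta_ge0//.
by rewrite (le_lt_trans (damped_beta_le mu w0))// -/B BE ltry.
Qed.

(** [integrated_hit_upper] with [eta = e], as the grid is refined. *)
Let near_zero_upper t b e : 0 < t < b -> b < 1 -> 0 < e -> e ^+ 2 <= r * t ->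
  (P (near_zero e t b) * damped_beta mu ((e + e) ^+ 2 / 2 / (1 - b))%R <= K t 1)%E.
Proof.
move=> /andP[t0 tb] b1 e0 ert.
have w0 : 0 <= (e + e) ^+ 2 / 2 / (1 - b).
  by rewrite !divr_ge0 ?sqr_ge0// subr_ge0 ltW.
have h := cvgeZr (damped_fin w0) (@cvg_some_small e t b).
rewrite -(cvg_lim _ h)//; apply: lime_le; first by apply/cvg_ex; eexists; exact: h.
apply: nearW => n; apply: (integrated_hit_upper (C := C) (r := r)) => //.
- exact: ltW.
- by move=> i; rewrite -{1}(grid0 t b n) grid_nd// ltW.
- move=> i i2; rewrite -[leRHS](grid_last t b n) grid_nd// ?(ltW tb)//.
- by move=> i j; apply: grid_nd; exact: ltW.
Qed.

Let zero_in_upper t b : 0 < t < b -> b < 1 -> (P (zero_in t b) * B <= K t 1)%E.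
Proof.
move=> /andP[t0 tb] b1.
have h : (P (zero_in t b) * damped_beta mu (k.+1%:R^-1)%R)%E @[k --> \oo] -->
   (P (zero_in t b) * B)%E.
  apply: cvgeZl; last exact: cvg_damped_beta.
  by rewrite fin_num_measure//; apply: measurable_zero_in; rewrite tb ltW.
rewrite -(cvg_lim _ h)//; apply: lime_le; first by apply/cvg_ex; eexists; exact: h.
apply: nearW => k.
(* The damping parameter is [2 * e ^ 2 / (1 - b)]. As [e <= 1] gives [e ^ 2 <= e], the other two
   bounds make it at most [1 / (k + 1)] and ensure [e ^ 2 <= r * t]. *)
pose e := Num.min (Num.min 1 ((1 - b) / (2 * k.+1%:R))) (r * t).
have e0 : 0 < e.
  by rewrite /e !lt_min ltr01 divr_gt0 ?subr_gt0// mulr_gt0.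
have [e1 [ek ert]] : e <= 1 /\ e <= (1 - b) / (2 * k.+1%:R) /\ e <= r * t.
  by rewrite /e !ge_min !lexx !orbT.
have ee : e ^+ 2 <= e by rewrite expr2 ler_piMr// ltW.
have tbb : 0 < t < b by rewrite t0.
apply: le_trans (near_zero_upper tbb b1 e0 (le_trans ee ert)).
apply: lee_pmul; rewrite ?damped_beta_ge0//.
  apply: le_measure; rewrite ?inE.
  - by apply: measurable_zero_in; rewrite tb ltW.
  - exact: measurable_near_zero.
  - by apply: sub_near_zero; rewrite ?tb ?ltW.
apply: damped_beta_le; rewrite ler_pdivrMr ?subr_gt0//.
have -> : (e + e) ^+ 2 / 2 = e ^+ 2 * 2 by field.
rewrite -ler_pdivlMr//; apply: (le_trans ee); apply: (le_trans ek).
rewrite le_eqVlt; apply/orP; left; apply/eqP.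
have : k.+1%:R != 0 :> R by rewrite pnatr_eq0.
by generalize (k.+1%:R : R) => m m0; field.
Qed.

(** The order of limits matters: refining the grid at fixed [eta] removes the jump term, which could
    not survive the division by [eta ^ (2 - 2 mu)]; only then does [eta] tend to 0. *)
Let near_zero_lower t k e : 0 < t < 1 -> 0 < k -> 0 < e ->
  (K t (1 - k)%R <= P (near_zero e t 1) * B)%E.
Proof.
move=> /andP[t0 t1] k0 e0.
have [mu0 mu1] : 0 < mu /\ mu < 1 by apply/andP.
have KB : (K t (1 - k)%R <= B)%E.
  rewrite /B damped_beta0; apply: ge0_subset_integral => //.
  - by apply/measurable_EFinP; apply: measurable_funTS; exact: measurable_beta_dens.
  - by move=> x _; rewrite lee_fin beta_dens_ge0.
  - move=> x /=; rewrite !in_itv/= => /andP[tx xk].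
    by rewrite (lt_trans t0 tx) (lt_trans xk)// ltrBlDr ltrDl.
have K0 : (0 <= K t (1 - k)%R)%E by apply: integral_ge0 => x _; rewrite lee_fin beta_dens_ge0.
have Kfin : K t (1 - k)%R \is a fin_num.
  by rewrite ge0_fin_numE// (le_lt_trans KB)// BE ltry.
have mnz := measurable_near_zero e t 1.
have Bfin : B \is a fin_num by rewrite BE.
pose I := fine (K t (1 - k)%R); pose b := fine B; pose p := fine (P (near_zero e t 1)).
have IE : K t (1 - k)%R = I%:E by rewrite /I fineK.
have bE : B = b%:E by rewrite /b fineK.
have pE : P (near_zero e t 1) = p%:E by rewrite /p fineK// fin_num_measure.
rewrite IE bE pE -EFinM lee_fin.
have step eta : 0 < eta < e -> C * eta `^ (2 - 2 * mu) * expR (- (eta ^+ 2 / (2 * t))) * I <=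
    C * eta `^ (2 - 2 * mu) * (p * b) + k `^ (- mu) * (eta ^+ 2 / r).
  move=> /andP[eta0 etae]; rewrite -lee_fin.
  (* [eta < e'] is required to detect the jump at rational times, and [e' < e] to make its
     probability tend to 0. *)
  pose e' := (eta + e) / 2.
  have etae' : 0 < eta < e' by rewrite /e' eta0/=; lra.
  have e'e : e' < e by rewrite /e'; lra.
  have hJ := @jump_cvg0 R d T P Z e e' cZ e'e.
  set c := (C * eta `^ (2 - 2 * mu) * (p * b) + k `^ (- mu) * (eta ^+ 2 / r)).
  have h : (c%:E + (k `^ (- mu))%:E * P (jump Z e e' n))%E @[n --> \oo] --> (c%:E)%E.
    rewrite -[X in _ --> X]adde0; apply: cvgeD => //; first exact: cvg_cst.
    by rewrite -(mule0 (k `^ (- mu))%:E); apply: cvgeZl.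
  rewrite -(cvg_lim _ h)//; apply: lime_ge; first by apply/cvg_ex; eexists; exact: h.
  apply: nearW => n; rewrite EFinM -IE.
  apply: le_trans (@integrated_hit_lower _ _ _ _ _ mu C r e e' (grid t 1 n) (2 ^ n)%N n
    t eta k mu0 C0 t0 k0 _ _ _ _ hge hle cZ Z0 etae' r0) _.
  - by move=> i; rewrite -{1}(grid0 t 1 n) grid_nd// ltW.
  - by move=> i; exact: grid_lt.
  - by move=> i j; apply: grid_nd; exact: ltW.
  - move=> a /andP[ta a1]; have /(grid_cover n)[i [iN ia ai]] : t < a <= 1 by rewrite ta ltW.
    exists i; split => //; apply: (le_lt_trans ai).
    rewrite ltr_pdivrMr ?exprn_gt0//.
    have n0 : 0 < n.+1%:R :> R by [].
    rewrite mulrC ltr_pdivlMr//; apply: lt_le_trans (natrS_lt_exprn n).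
    by rewrite gtr_pMl//; lra.
  apply: leeD2r; rewrite /c EFinD; apply: leeD2r; rewrite [leRHS]EFinM; apply: lee_wpmul2l.
    by rewrite lee_fin mulr_ge0 ?powR_ge0// ltW.
  rewrite -/B EFinM -pE -bE; apply: lee_wpmul2r; first exact: damped_beta_ge0.
  apply: le_measure; rewrite ?inE//; first exact: measurable_some_small.
  by move=> w [i iN wi]; exists n => //; exists i => //; rewrite ltnS ltnW.
(* After division by [C * eta ^ (2 - 2 mu)] the short-time error is of order [eta ^ (2 mu)], which
   vanishes since [mu > 0]. *)
have step2 eta : 0 < eta < e ->
    expR (- (eta ^+ 2 / (2 * t))) * I <= p * b + k `^ (- mu) / (r * C) * eta `^ (2 * mu).
  move=> etae; have := step eta etae; case/andP: etae => eta0 etae.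
  have q0 : 0 < C * eta `^ (2 - 2 * mu) by rewrite mulr_gt0// powR_gt0.
  have e2 : eta ^+ 2 = eta `^ (2 - 2 * mu) * eta `^ (2 * mu).
    rewrite -powRD ?(gt_eqF eta0) ?implybT//.
    by rewrite subrK powR_mulrn// ltW.
  have e3 : C * eta `^ (2 - 2 * mu) * (p * b + k `^ (- mu) / (r * C) * eta `^ (2 * mu)) =
      C * eta `^ (2 - 2 * mu) * (p * b) + k `^ (- mu) * (eta ^+ 2 / r).
    by rewrite e2; field; rewrite (gt_eqF r0) (gt_eqF C0).
  by move=> h; rewrite -(ler_pM2l q0) e3 [leLHS]mulrA.
have h1 : expR (- (eta ^+ 2 / (2 * t))) * I @[eta --> 0^'+] --> expR (- (0 ^+ 2 / (2 * t))) * I.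
  apply: cvgMl; apply: cvg_at_right_filter; apply: continuous_cvg; first exact: continuous_expR.
  by apply: cvgN; apply: cvgMl; exact: exprn_continuous.
have h2 : p * b + k `^ (- mu) / (r * C) * eta `^ (2 * mu) @[eta --> 0^'+] -->
    p * b + k `^ (- mu) / (r * C) * 0.
  apply: cvgD; first exact: cvg_cst.
  by apply: cvgMr; apply: powR_cvg0; rewrite mulr_gt0.
have := ler_cvg_to h1 h2; rewrite expr0n/= mul0r oppr0 expR0 mul1r mulr0 addr0; apply.
near=> eta; apply: step2; apply/andP; split.
  by near: eta; exact: nbhs_right_gt.
by near: eta; exact: nbhs_right_lt.
Unshelve. all: by end_near. Qed.

Let zero_in_lower t : 0 < t < 1 -> (K t 1 <= P (zero_in t 1) * B)%E.
Proof.
move=> t01; have /andP[t0 t1] := t01.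
have t01' : 0 <= t < 1 by rewrite (ltW t0).
have lower k : 0 < k -> (K t (1 - k)%R <= P (zero_in t 1) * B)%E.
  move=> k0.
  have Bfin : B \is a fin_num by rewrite BE.
  have h := cvgeZr Bfin (cvg_near_zero t01').
  rewrite -(cvg_lim _ h)//; apply: lime_ge; first by apply/cvg_ex; eexists; exact: h.
  by apply: nearW => i; apply: near_zero_lower => //; rewrite invr_gt0.
pose F (n : nat) : set R := `]t, (1 - n.+1%:R^-1)%R[%classic.
have h : (\int[lebesgue_measure]_(a in F n) (beta_dens mu a)%:E @[n --> \oo] -->
    \int[lebesgue_measure]_(a in \bigcup_n F n) (beta_dens mu a)%:E)%E.
  apply: ge0_nondecreasing_set_cvg_integral.
  - move=> m n mn; apply/subsetPset => x; rewrite /F /= !in_itv/= => /andP[-> xm].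
    by apply: (lt_le_trans xm); rewrite lerD2l lerN2 lef_pV2 ?posrE// ler_nat.
  - by move=> n; exact: measurable_itv.
  - move=> n; apply/measurable_EFinP; apply: measurable_funTS.
    exact: measurable_beta_dens.
  - by move=> n x _; rewrite lee_fin beta_dens_ge0.
have FE : \bigcup_n F n = `]t, 1[%classic.
  apply/seteqP; split => x /=.
    move=> [n _]; rewrite /F /= !in_itv/= => /andP[-> xn].
    by apply: (lt_trans xn); rewrite ltrBlDr ltrDl invr_gt0.
  rewrite in_itv/= => /andP[tx x1].
  have /cvgrPdist_lt/(_ (1 - x)) := @cvg_harmonic R.
  rewrite subr_gt0 x1 => /(_ isT)[n _ /(_ n (leqnn n))] /=.
  rewrite sub0r normrN ger0_norm// => hn; exists n => //.
  by rewrite /F /= in_itv/= tx ltrBrDr -ltrBrDl.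
rewrite /K -FE -(cvg_lim _ h)//; apply: lime_le; first by apply/cvg_ex; eexists; exact: h.
by apply: nearW => n; apply: lower; rewrite invr_gt0.
Qed.

(** Upper small ball bound at time 1, with [eta] tending to 0: the exponent [2 - 2 * mu] is
    positive. *)
Lemma prob_small_one0 : P (small Z 1 0) = 0%E.
Proof.
have [mu0 mu1] : 0 < mu /\ mu < 1 by apply/andP.
apply/eqP; rewrite eq_le measure_ge0 andbT.
have pE : P (small Z 1 0) = (fine (P (small Z 1 0)))%:E.
  by rewrite fineK// fin_num_measure//; exact: measurable_small.
rewrite pE lee_fin.
have h : C * eta `^ (2 - 2 * mu) @[eta --> 0^'+] --> C * 0.
  by apply: cvgMr; apply: powR_cvg0; lra.
have h0 : fine (P (small Z 1 0)) @[eta --> (0 : R)^'+] --> fine (P (small Z 1 0)).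
  exact: cvg_cst.
have := ler_cvg_to h0 h; rewrite mulr0; apply.
near=> eta.
have eta0 : 0 < eta by near: eta; exact: nbhs_right_gt.
have eta1 : eta < 1 by near: eta; exact: nbhs_right_lt.
have etar : eta < r by near: eta; exact: nbhs_right_lt.
rewrite -lee_fin -pE.
have := @hle 0 1 eta setT; rewrite subr0 lexx ltr01 => /(_ isT eta0).
have : eta ^+ 2 <= r * 1 by rewrite mulr1 expr2; nra.
move=> + => /[swap] /[apply] /(_ (@natural_filtrationT _ _ _ P Z 0)).
rewrite setTI probability_setT mule1 powR1 mulr1; apply: le_trans.
apply: le_measure; rewrite ?inE; [exact: measurable_small|exact: measurable_small|].
by move=> w; rewrite /small/= => /le_trans; apply; exact: ltW.
Unshelve. all: by end_near. Qed.

(** The upper bound is available on [[t, b]] with [b < 1] only. Letting [b] increase to 1 misses at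
    most a zero at time 1 itself, a null event. *)
Lemma prob_zero_in t : 0 < t < 1 -> (P (zero_in t 1) * B = K t 1)%E.
Proof.
move=> t01; have /andP[t0 t1] := t01.
have t01' : 0 <= t < 1 by rewrite (ltW t0).
apply/eqP; rewrite eq_le zero_in_lower// andbT.
(* The 2 keeps [t < b n] at [n = 0]. *)
pose b (n : nat) : R := 1 - (1 - t) / (n%:R + 2).
have bt n : t < b n < 1.
  have n0 : 0 <= n%:R :> R by [].
  have h : (1 - t) / (n%:R + 2) < 1 - t by rewrite ltr_pdivrMr ?ltr_wpDl//; nra.
  have h' : 0 < (1 - t) / (n%:R + 2) by rewrite divr_gt0 ?subr_gt0 ?ltr_wpDl.
  by rewrite /b; lra.
have b_nd m n : (m <= n)%N -> b m <= b n.
  move=> mn; rewrite /b lerD2l lerN2 ler_wpM2l ?subr_ge0 ?(ltW t1)//.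
  by rewrite lef_pV2 ?posrE ?ltr_wpDl// lerD2r ler_nat.
have mzb n : measurable (zero_in t (b n)).
  by apply: measurable_zero_in; have /andP[-> _] := bt n; rewrite ltW.
have mU : measurable (\bigcup_n zero_in t (b n)) by exact: bigcupT_measurable.
have mz1 := measurable_zero_in t01'.
have U : zero_in t 1 `<=` (\bigcup_n zero_in t (b n)) `|` small Z 1 0.
  move=> w [u /andP[tu]]; rewrite le_eqVlt => /predU1P[->|u1] Zu.
    by right; rewrite /small/= Zu normr0.
  left.
  have [n hn] : exists n, u <= b n.
    have /cvgrPdist_lt/(_ (1 - u)) := @cvg_add_natr_inv R 2 1 ltr01.
    rewrite subr_gt0 u1 => /(_ isT)[n _ /(_ n (leqnn n))] /=.
    rewrite sub0r normrN mul1r ger0_norm ?invr_ge0 ?addr_ge0// => hn; exists n.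
    rewrite /b lerBrDl -lerBrDr; apply: le_trans (ltW hn).
    rewrite (addrC 2) ler_piMl ?invr_ge0 ?addr_ge0// lerBlDr lerDl ltW//.
  by exists n => //; exists u; rewrite ?tu.
have Ple : (P (zero_in t 1) <= P (\bigcup_n zero_in t (b n)))%E.
  apply: (@le_trans _ _ (P ((\bigcup_n zero_in t (b n)) `|` small Z 1 0))).
    apply: le_measure; rewrite ?inE//; apply: measurableU => //.
    exact: measurable_small.
  apply: (le_trans (measureU2 _ _ _)) => //; first exact: measurable_small.
  by rewrite [X in (_ + X)%E](_ : _ = 0%E) ?adde0//; exact: prob_small_one0.
have Bfin : B \is a fin_num by rewrite BE.
have hU : P (zero_in t (b n)) @[n --> \oo] --> P (\bigcup_n zero_in t (b n)).
  apply: (nondecreasing_cvg_mu (F := fun n => zero_in t (b n))) => //.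
  move=> m n mn; apply/subsetPset => w [u /andP[tu ub] Zu]; exists u => //.
  by rewrite tu (le_trans ub)// b_nd.
have h := cvgeZr Bfin hU.
apply: (@le_trans _ _ (P (\bigcup_n zero_in t (b n)) * B)%E).
  by apply: lee_wpmul2r => //; exact: damped_beta_ge0.
rewrite -(cvg_lim _ h)//; apply: lime_le; first by apply/cvg_ex; eexists; exact: h.
apply: nearW => n; have /andP[h1 h2] := bt n.
by apply: zero_in_upper; rewrite // t0.
Qed.

End zeros.

(** * The law of the last zero *)

Section last_zero_density.
Context {R : realType} {d : measure_display} {T : measurableType d}.
Variables (P : probability T R) (Z : R -> {RV P >-> R}).
Implicit Types (t b : R).

Lemma integral_measure (h : R -> \bar R) : measurable_fun setT h ->
  (forall x, (0 <= h x)%E) ->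
  exists m : {measure set (measurableTypeR R) -> \bar R},
    forall U, m U = (\int[lebesgue_measure]_(x in U) h x)%E.
Proof.
move=> mh h0.
pose f (U : set (measurableTypeR R)) := (\int[lebesgue_measure]_(x in U) h x)%E.
have f0 : f set0 = 0%E by rewrite /f integral_set0.
have f_ge0 U : (0 <= f U)%E by exact: integral_ge0.
have f_sa : semi_sigma_additive f.
  move=> F mF tF mUF; rewrite /f ge0_integral_bigcup//=; last first.
    exact: measurable_funTS.
  by apply: is_cvg_nneseries => n _ _; exact: integral_ge0.
pose m := HB.pack_for {measure set (measurableTypeR R) -> \bar R} f
  (isMeasure.Build _ _ _ f f0 f_ge0 f_sa).
by exists m.
Qed.

Hypothesis cZ : continuous_paths Z.

Let zeros w : set R := [set t | 0 <= t <= 1 /\ Z t w = 0].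

Let zeros_ub w : ubound (zeros w) 1.
Proof. by move=> t [/andP[]]. Qed.

Lemma last_zero_ge0 w : 0 <= last_zero Z w.
Proof.
rewrite /last_zero -/(zeros w).
have [->|/set0P[t zt]] := eqVneq (zeros w) set0; first by rewrite sup0.
apply: (@le_trans _ _ t); first by case: zt => /andP[].
by apply: ub_le_sup zt; exists 1; exact: zeros_ub.
Qed.

Lemma last_zero_le1 w : last_zero Z w <= 1.
Proof.
rewrite /last_zero -/(zeros w).
have [->|z0] := eqVneq (zeros w) set0; first by rewrite sup0.
by apply: ge_sup (@zeros_ub w); exact/set0P.
Qed.

(** The zero set is closed, so a supremum of a nonempty one is attained. Positivity of [t] excludes
    the empty zero set, whose [sup] is 0 by convention. *)
Lemma last_zero_ge t w : 0 < t -> t <= last_zero Z w <-> zero_in Z t 1 w.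
Proof.
move=> t0; split=> [tg|[s /andP[ts s1] Zs]]; last first.
  apply: (le_trans ts); apply: ub_le_sup; first by exists 1; exact: zeros_ub.
  by split => //; rewrite s1 (le_trans (ltW t0)).
have g0 := last_zero_ge0 w; have g1 := last_zero_le1 w.
exists (last_zero Z w); first by rewrite tg.
apply/eqP; apply: contraT => Zg.
have [r r0 hr] : exists2 r, 0 < r & forall v, 0 <= v -> `|last_zero Z w - v| < r ->
    `|Z (last_zero Z w) w - Z v w| < `|Z (last_zero Z w) w|.
  by apply: path_near => //; rewrite normr_gt0.
have z0 : zeros w !=set0.
  apply/set0P; apply: contraTneq tg; rewrite /last_zero -/(zeros w) => ->.
  by rewrite sup0 -ltNge.
have hs : has_sup (zeros w) by split => //; exists 1; exact: zeros_ub.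
have [v [/andP[v0 v1] Zv] gv] := sup_adherent r0 hs.
have vg : v <= last_zero Z w.
  by apply: ub_le_sup; [exists 1; exact: zeros_ub|split => //; rewrite v0].
have : `|Z (last_zero Z w) w - Z v w| < `|Z (last_zero Z w) w|.
  by apply: hr => //; rewrite ger0_norm ?subr_ge0// ltrBlDr -ltrBlDl.
by rewrite Zv subr0 ltxx.
Qed.

Let zero_in1 : zero_in Z 1 1 = small Z 1 0.
Proof.
apply/seteqP; split => w; rewrite /small/= normr_le0.
  by move=> [s s1] Zs; have <- : s = 1 by [lra]; rewrite Zs.
by move=> /eqP Z1; exists 1; rewrite ?lexx.
Qed.

Lemma last_zero_preimage t : last_zero Z @^-1` `[t, +oo[ =
  if t <= 0 then setT else if 1 < t then set0 else zero_in Z t 1.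
Proof.
case: ifPn => [t0|]; rewrite -?ltNge.
  by apply/seteqP; split => // w _ /=; rewrite in_itv/= andbT (le_trans t0)// last_zero_ge0.
move=> t0; case: ifPn => [t1|_].
  apply/seteqP; split => // w /=; rewrite in_itv/= andbT => /(lt_le_trans t1).
  by rewrite ltNge last_zero_le1.
apply/seteqP; split => w /=; rewrite in_itv/= andbT => /last_zero_ge; exact.
Qed.

Lemma measurable_last_zero : measurable_fun setT (last_zero Z).
Proof.
apply: (measurability (@RGenCInfty.G R)).
  exact: RGenCInfty.measurableE.
move=> _ [_ [t ->] <-]; rewrite setTI last_zero_preimage.
case: ifPn => // t0; case: ifPn => // t1.
(* [measurable_zero_in] concerns nondegenerate intervals, hence the separate case [t = 1]. *)
have [->|tn1] := eqVneq t 1; first by rewrite zero_in1; exact: measurable_small.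
by apply: measurable_zero_in => //; move: t0 t1; rewrite -ltNge -leNgt => t0 t1; rewrite ltW//= lt_neqAle tn1.
Qed.

(** The rays [[t, +oo[] form a generating family stable under intersection, so agreement there
    determines the law. *)
Lemma has_density_last_zero (h : R -> R) : measurable_fun setT h ->
  (forall x, 0 <= h x) ->
  (forall t, 0 < t < 1 ->
    P (zero_in Z t 1) = (\int[lebesgue_measure]_(x in `]t, 1%R[) (h x)%:E)%E) ->
  (\int[lebesgue_measure]_(x in `]0%R, 1%R[) (h x)%:E = 1)%E ->
  P (small Z 1 0) = 0%E ->
  has_density01 P (last_zero Z) h.
Proof.
move=> mh h0 zh h1 Z1; split; first exact: measurable_last_zero.
pose f : R -> \bar R := (fun x => (h x)%:E) \_ `]0, 1[.
have [|x|m2 m2E] := @integral_measure f.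
- apply/(measurable_restrictT _ _).1 => //; apply/measurable_EFinP.
  exact: measurable_funTS.
- by apply: erestrict_ge0 => y _; rewrite lee_fin.
have [m1 m1E] := @pushforward_measure _ _ T (measurableTypeR R) R P _ measurable_last_zero.
move=> U mU; rewrite integral_mkcondr -/f -m2E.
have -> : P (last_zero Z @^-1` U) = m1 U by rewrite m1E.
apply: (@measure_unique _ R (measurableTypeR R) (@RGenCInfty.G R) (fun k => `[(- k%:R)%R, +oo[%classic) _ _ _ _ m1 m2 _ _ U mU) => //.
- exact: RGenCInfty.measurableE.
- move=> _ _ [x ->] [y ->]; exists (Num.max x y).
  by apply/seteqP; split => z /=; rewrite !in_itv/= !andbT ge_max; [move=> [-> ->]|move=> /andP[]].
- by move=> k; exists (- k%:R).
- apply/seteqP; split => // x _.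
  have [n _ /(_ n (leqnn n)) /= xn] := @nbhs_infty_gtr R (- x).
  by exists n => //=; rewrite in_itv/= andbT lerNl ltW.
- move=> _ [t ->]; rewrite m1E m2E /pushforward last_zero_preimage -integral_mkcondr.
  have fT : (\int[lebesgue_measure]_(x in `]0%R, 1%R[) (h x)%:E = 1)%E by [].
  case: ifPn => [t0|]; last rewrite -ltNge => t0.
    rewrite [LHS](_ : _ = 1%E); last exact: probability_setT.
    have -> // : `[t, +oo[ `&` `]0, 1[ = `]0, 1[%classic :> set R.
    apply/seteqP; split => x /=; first by case.
    by rewrite !in_itv/= andbT => /andP[x0 x1]; rewrite x0 x1 (le_trans t0) ?ltW.
  case: ifPn => [t1|]; last rewrite -leNgt => t1.
    rewrite [LHS](_ : _ = 0%E); last exact: measure0.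
    have -> : `[t, +oo[ `&` `]0, 1[ = set0 :> set R.
      apply/seteqP; split => x //=; rewrite !in_itv/= andbT => -[tx /andP[_ x1]].
      by have := lt_trans (lt_le_trans t1 tx) x1; rewrite ltxx.
    by rewrite integral_set0.
  have [->|tn1] := eqVneq t 1.
    rewrite zero_in1 [LHS](_ : _ = 0%E); last exact: Z1.
    have -> : `[1, +oo[ `&` `]0, 1[ = set0 :> set R.
      apply/seteqP; split => x //=; rewrite !in_itv/= andbT => -[tx /andP[_ x1]].
      by have := le_lt_trans tx x1; rewrite ltxx.
    by rewrite integral_set0.
  have {}t1 : t < 1 by rewrite lt_neqAle tn1.
  have t01 : 0 < t < 1 by rewrite t0.
  transitivity (\int[lebesgue_measure]_(x in `]t, 1%R[) (h x)%:E)%E; first exact: zh.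
  have -> : `[t, +oo[ `&` `]0, 1[ = `[t, 1[%classic :> set R.
    apply/seteqP; split => x /=; rewrite !in_itv/= andbT.
      by move=> [-> /andP[_ ->]].
    by move=> /andP[tx x1]; rewrite tx x1 (lt_le_trans t0).
  rewrite integral_itv_obnd_cbnd//; apply/measurable_EFinP.
  exact: measurable_funTS.
- move=> k; rewrite m1E /pushforward (le_lt_trans (probability_le1 _ _)) ?ltry//.
  rewrite -[X in measurable X]setTI; apply: measurable_last_zero => //.
Qed.

End last_zero_density.

(** * Small ball estimates for Bessel processes *)

Section gamma.
Variable R : realType.
Implicit Types (a x y : R).

Lemma integral_expRN x :
  (\int[lebesgue_measure]_(y in `]x, +oo[) (expR (- y))%:E = (expR (- x))%:E)%E.
Proof.
have cN : continuous (fun y : R => expR (- y)).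
  by move=> y; apply: continuous_comp; [exact: opp_continuous|exact: continuous_expR].
rewrite integral_itv_obnd_cbnd; last first.
  apply/measurable_EFinP; apply: measurable_funTS.
  exact: continuous_measurable_fun.
rewrite (@ge0_continuous_FTC2y _ _ (fun y => - expR (- y)) x 0).
- by rewrite sub0e -EFinN opprK.
- by move=> y _; exact: expR_ge0.
- exact: continuous_subspaceT.
- by rewrite -oppr0; apply: cvgN; exact: cvgr_expR.
- by move=> y _.
- by apply: cvg_at_right_filter; apply: cvgN; exact: cN.
- move=> y _; rewrite derive1E derive_val /GRing.scale/=; ring.
Qed.

Lemma integral_powR_itv a y : 0 < a -> 0 < y ->
  (\int[lebesgue_measure]_(x in `]0%R, y[) (x `^ (a - 1))%:E = (y `^ a / a)%:E)%E.
Proof.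
move=> a0 y0; rewrite -[y `^ a / a]subr0.
apply: (@ge0_itvoo_FTC _ _ (fun x => x `^ a / a)) => //.
- move=> x; rewrite in_itv/= => /andP[x0 _].
  have h := is_derive1_powR a x0.
  have h2 := is_deriveM h (@is_derive_cst R R R (a^-1 : R) x (1 : R)).
  apply: (is_derive_eq h2); rewrite /GRing.scale/= mulr0 add0r; field.
  exact: lt0r_neq0.
- move=> x; rewrite in_itv/= => /andP[x0 _].
  apply: differentiable_continuous; apply/derivable1_diffP.
  by have [] := is_derive1_powR (a - 1) x0.
- by move=> x _; exact: powR_ge0.
- by rewrite -[X in _ --> X](mul0r a^-1); apply: cvgMl; exact: powR_cvg0.
- have cy : {for y, continuous (fun x : R => x `^ a)}.
    apply: differentiable_continuous; apply/derivable1_diffP.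
    by have [] := is_derive1_powR a y0.
  by apply: cvg_at_left_filter; apply: cvgMl; exact: cy.
Qed.

(** Extended-real version of [gammaR], for which the recursion holds whether or not the integral
    converges. *)
Definition gammae a : \bar R :=
  (\int[lebesgue_measure]_(x in `]0%R, +oo[) (x `^ (a - 1) * expR (- x))%:E)%E.

Lemma gammae_ge0 a : (0 <= gammae a)%E.
Proof. by apply: integral_ge0 => x _; rewrite lee_fin mulr_ge0 ?powR_ge0 ?expR_ge0. Qed.

Lemma gammaRE a : gammaR a = fine (gammae a).
Proof. by []. Qed.

Lemma gammaR_ge0 a : 0 <= gammaR a.
Proof. by rewrite gammaRE fine_ge0// gammae_ge0. Qed.

(** Tonelli for x^(a-1) e^(-y) on [0 < x < y]: integrating first in y leaves the integral at [a],
    first in x the integral at [a + 1] divided by [a]. *)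
Lemma gammaeS a : 0 < a -> (a%:E * gammae a = gammae (a + 1))%E.
Proof.
move=> a0.
pose D : set (R * R) := [set z | 0 < z.1 < z.2].
have mD : measurable D.
  have m2 : measurable_fun setT (fun z : R * R => z.2 - z.1).
    by apply: measurable_funB; [exact: measurable_snd|exact: measurable_fst].
  rewrite (_ : D = (setT `&` fst @^-1` `]0, +oo[) `&`
      (setT `&` (fun z : R * R => z.2 - z.1) @^-1` `]0, +oo[)).
    by apply: measurableI; [exact: measurable_fst|exact: m2].
  apply/seteqP; split => z /=; rewrite !in_itv/= !andbT subr_gt0.
    by move=> /andP[h1 h2]; split.
  by move=> [[_ h1] [_ h2]]; apply/andP.
pose f : R * R -> \bar R := (fun z => (z.1 `^ (a - 1) * expR (- z.2))%:E) \_ D.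
have mf : measurable_fun setT f.
  apply/(measurable_restrictT _ _).1 => //; apply/measurable_EFinP.
  apply: measurable_funTS; apply: measurable_funM.
    by apply: (measurableT_comp (measurable_powR _)); exact: measurable_fst.
  apply: measurableT_comp; first exact: measurable_expR.
  by apply: measurable_funN; exact: measurable_snd.
have memD (x y : R) : ((x, y) \in D) = (0 < x < y).
  by apply/idP/idP => [/set_mem//|h]; exact: mem_set.
have f0 z : (0 <= f z)%E.
  by apply: erestrict_ge0 => ? _; rewrite lee_fin mulr_ge0 ?powR_ge0 ?expR_ge0.
have := @fubini_tonelli _ _ _ _ R (@lebesgue_measure R) (@lebesgue_measure R) f mf f0.
have -> : (\int[lebesgue_measure]_x fubini_F lebesgue_measure f x = gammae a)%E.
  rewrite /gammae [RHS]integral_mkcond; apply: eq_integral => x _.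
  rewrite /fubini_F patchE mem_setE in_itv/= andbT; case: ifPn => x0; last first.
    rewrite -[RHS](@integral0 _ _ _ (@lebesgue_measure R) setT).
    apply: eq_integral => y _; rewrite /f patchE ifF//.
    by apply/negP => /set_mem /andP[/= h _]; rewrite h in x0.
  rewrite EFinM -integral_expRN -ge0_integralZl_EFin ?powR_ge0//; last first.
    apply/measurable_EFinP; apply: measurable_funTS; apply: measurableT_comp => //.
  rewrite [RHS]integral_mkcond; apply: eq_integral => y _.
  by rewrite /f !patchE memD mem_setE in_itv/= andbT x0/= -EFinM.
have -> : (\int[lebesgue_measure]_x fubini_G lebesgue_measure f x =
    (a^-1)%:E * gammae (a + 1))%E.
  rewrite /gammae -ge0_integralZl_EFin//; last 3 first.
  - by move=> x _; rewrite lee_fin mulr_ge0 ?powR_ge0 ?expR_ge0.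
  - apply/measurable_EFinP; apply: measurable_funTS; apply: measurable_funM.
      exact: measurable_powR.
    by apply: measurableT_comp; [exact: measurable_expR|exact: measurable_funN].
  - by rewrite invr_ge0 ltW.
  rewrite [RHS]integral_mkcond; apply: eq_integral => y _.
  rewrite /fubini_G patchE mem_setE in_itv/= andbT; case: ifPn => y0; last first.
    rewrite -[RHS](@integral0 _ _ _ (@lebesgue_measure R) setT).
    apply: eq_integral => x _; rewrite /f patchE ifF//.
    by apply/negP => /set_mem /andP[/= h1 h2]; rewrite (lt_trans h1 h2) in y0.
  rewrite addrK -EFinM.
  have -> : (a^-1 * (y `^ a * expR (- y)) = expR (- y) * (y `^ a / a))%R by ring.
  rewrite EFinM -integral_powR_itv// -ge0_integralZl_EFin ?expR_ge0//; last 2 first.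
  - by move=> x _; rewrite lee_fin powR_ge0.
  - apply/measurable_EFinP; apply: measurable_funTS; exact: measurable_powR.
  rewrite [RHS]integral_mkcond; apply: eq_integral => x _.
  by rewrite /f !patchE memD mem_setE in_itv/= -EFinM mulrC.
move=> ->; rewrite muleA -EFinM divff ?mul1e//; exact: lt0r_neq0.
Qed.

End gamma.

(** * Bounds on the Bessel function and on the transition density *)

Section bessel.
Variable R : realType.
Implicit Types (b mu a x y z : R) (k : nat).

(* [gammaR] is 0 where the integral diverges, and then so is its inverse, which
   is harmless in the upper bound on the series. *)
Lemma gammaR_lower b k : 0 < b -> 0 < gammaR b ->
  gammaR (b + k%:R) = 0 \/ b ^+ k * gammaR b <= gammaR (b + k%:R).
Proof.
move=> b0 gb.
have h : ((b ^+ k)%:E * gammae b <= gammae (b + k%:R))%E.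
  elim: k => [|k IH]; first by rewrite expr0 mul1e addr0.
  have bk0 : 0 < b + k%:R by rewrite ltr_wpDr.
  rewrite -natr1 addrA -gammaeS// exprS EFinM -muleA.
  apply: (@le_trans _ _ (b%:E * gammae (b + k%:R))%E).
    by apply: lee_wpmul2l; rewrite // lee_fin ltW.
  by apply: lee_wpmul2r; [exact: gammae_ge0|rewrite lee_fin lerDl].
have bfin : gammae b \is a fin_num.
  rewrite ge0_fin_numE ?gammae_ge0// ltNge leye_eq; apply/negP => /eqP e.
  by move: gb; rewrite gammaRE e ltxx.
rewrite !gammaRE; move: h (gammae_ge0 (b + k%:R)); rewrite -(fineK bfin).
case: (gammae (b + k%:R)) => [r| |]//= h _; [right|by left].
by rewrite -lee_fin EFinM.
Qed.

(** Terms of the series of I_nu(2z) with [b = nu + 1], the factor z^nu being left out. *)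
Definition bessel_coeff b z k : R := z ^+ (2 * k) / (k`!%:R * gammaR (b + k%:R)).

Lemma bessel_coeff_ge0 b z k : 0 <= bessel_coeff b z k.
Proof.
rewrite divr_ge0//; last by rewrite mulr_ge0// gammaR_ge0.
by rewrite exprM exprn_ge0 ?sqr_ge0.
Qed.

Lemma bessel_coeff_le b z k : 0 < b -> 0 < gammaR b ->
  bessel_coeff b z k <= exp_coeff (z ^+ 2 / b) k / gammaR b.
Proof.
move=> b0 gb; rewrite /bessel_coeff /exp_coeff.
have z0 : 0 <= z ^+ (2 * k) by rewrite exprM exprn_ge0 ?sqr_ge0.
have f0 : 0 < k`!%:R :> R by rewrite ltr0n fact_gt0.
have bk : 0 < b ^+ k by rewrite exprn_gt0.
have [->|h] := gammaR_lower k b0 gb.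
  rewrite mulr0 invr0 mulr0 !divr_ge0// ?(ltW gb)//.
  by rewrite exprn_ge0// divr_ge0 ?sqr_ge0// ltW.
rewrite /= expr_div_n -exprM.
have -> : z ^+ (2 * k) / b ^+ k / k`!%:R / gammaR b =
    z ^+ (2 * k) / (k`!%:R * (b ^+ k * gammaR b)).
  by field; rewrite !lt0r_neq0.
rewrite ler_wpM2l// lef_pV2 ?posrE ?mulr_gt0//; first by rewrite ler_pM2l.
by apply: lt_le_trans h; rewrite mulr_gt0.
Qed.

Definition bessel_sum b z : R := limn (series (bessel_coeff b z)).

(** Below, the term [k = 0] alone; above, Gamma(b+k) >= b^k Gamma(b) compares the series with the
    exponential one. *)
Lemma bessel_sum_bounds b z : 0 < b -> 0 < gammaR b ->
  (gammaR b)^-1 <= bessel_sum b z <= expR (z ^+ 2 / b) / gammaR b.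
Proof.
move=> b0 gb; rewrite /bessel_sum.
have nd : nondecreasing_seq (series (bessel_coeff b z)).
  apply/nondecreasing_seqP => n; rewrite /series/= big_nat_recr//= lerDl.
  exact: bessel_coeff_ge0.
have expc := @is_cvg_series_exp_coeff R (z ^+ 2 / b).
have x0 : 0 <= z ^+ 2 / b by rewrite divr_ge0 ?sqr_ge0// ltW.
have ub n : series (bessel_coeff b z) n <= expR (z ^+ 2 / b) / gammaR b.
  apply: (@le_trans _ _ (series (exp_coeff (z ^+ 2 / b)) n / gammaR b)).
    by rewrite /series/= mulr_suml; apply: ler_sum => i _; exact: bessel_coeff_le.
  rewrite ler_wpM2r ?invr_ge0 ?(ltW gb)//.
  apply: nondecreasing_cvgn_le => //.
  apply/nondecreasing_seqP => m; rewrite /series/= big_nat_recr//= lerDl.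
  by rewrite divr_ge0// exprn_ge0.
have cvgb : cvgn (series (bessel_coeff b z)).
  apply: nondecreasing_is_cvgn => //.
  by exists (expR (z ^+ 2 / b) / gammaR b) => _ [n _ <-].
apply/andP; split; last by apply: limr_le => //; apply: nearW.
have -> : (gammaR b)^-1 = series (bessel_coeff b z) 1.
  by rewrite /series/= big_nat1 /bessel_coeff muln0 expr0 fact0 mul1r addr0 mul1r.
exact: nondecreasing_cvgn_le.
Qed.

Lemma besselIE b z : besselI (b - 1) z =
  (z / 2) `^ (b - 1) * bessel_sum b (z / 2).
Proof.
rewrite /besselI /bessel_sum.
have -> : bessel_coeff b (z / 2) = (fun k => (z / 2) ^+ (2 * k) /
    (k`!%:R * gammaR (b - 1 + k%:R + 1))).
  by apply/funext => k; rewrite /bessel_coeff (addrAC b) subrK.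
by [].
Qed.

(** The density from 0 at time [a] without its Gaussian factor. *)
Definition bessel_lead mu a y : R :=
  2 `^ mu / gammaR (1 - mu) * a `^ (mu - 1) * y `^ (1 - 2 * mu).

(** With [z = x * y / (2 * a)], the Bessel sum contributes at most exp(z^2 / (1 - mu)), and z^2 / (1
    - mu) is [x ^ 2 / (2 * a)] times [y ^ 2 / (2 * (1 - mu) * a)]. The Gaussian factor absorbs it
    when the latter is at most 1: hence [r = 2 * (1 - mu)]. *)
Lemma bessel_density_bounds mu a x y : 0 < mu < 1 -> 0 < gammaR (1 - mu) ->
  0 < a -> 0 <= x -> 0 < y ->
  bessel_lead mu a y * expR (- ((x ^+ 2 + y ^+ 2) / (2 * a))) <=
    bessel_density (2 * (1 - mu)) a x y /\
  (y ^+ 2 <= 2 * (1 - mu) * a ->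
    bessel_density (2 * (1 - mu)) a x y <= bessel_lead mu a y).
Proof.
move=> /andP[mu0 mu1] g0 a0 x0 y0.
have nuE : 2 * (1 - mu) / 2 - 1 = - mu by field.
have lead0 : 0 < bessel_lead mu a y.
  by rewrite !mulr_gt0 ?powR_gt0 ?invr_gt0.
rewrite /bessel_density nuE; case: ifPn => [/eqP->|xn0].
  have -> : 2 `^ (- - mu) * a `^ (- (- mu + 1)) / gammaR (- mu + 1)
      * y `^ (2 * - mu + 1) = bessel_lead mu a y.
    rewrite /bessel_lead (addrC (- mu)) opprK opprB (addrC _ 1) mulrN; ring.
  rewrite expr0n/= add0r lexx; split => // _.
  rewrite ger_pMr// expR_le1 oppr_le0 divr_ge0 ?sqr_ge0//.
  by rewrite mulr_ge0// ltW.
have {xn0}x0 : 0 < x by rewrite lt0r xn0.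
have b0 : 0 < 1 - mu by lra.
have := besselIE (1 - mu) (x * y / a).
have -> : 1 - mu - 1 = - mu by ring.
move=> ->.
set z := x * y / a / 2.
have z0 : 0 < z by rewrite !divr_gt0 ?mulr_gt0.
have := bessel_sum_bounds z b0 g0.
set L := bessel_sum _ _ => /andP[L1 L2].
have -> : y / a * (y / x) `^ (- mu) * expR (- ((x ^+ 2 + y ^+ 2) / (2 * a))) *
   (z `^ (- mu) * L) =
   bessel_lead mu a y * (gammaR (1 - mu) * L) * expR (- ((x ^+ 2 + y ^+ 2) / (2 * a))).
  have e1 : (y / x) `^ (- mu) * z `^ (- mu) = (y ^+ 2 / a / 2) `^ (- mu).
    have yx0 : 0 <= y / x by rewrite divr_ge0 ?ltW.
    rewrite -(powRM _ yx0 (ltW z0)).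
    have -> : y / x * z = y ^+ 2 / a / 2 by rewrite /z; field; rewrite !lt0r_neq0.
    by [].
  have e2 : (y ^+ 2 / a / 2) `^ (- mu) = 2 `^ mu * a `^ mu * y `^ (- 2 * mu).
    have -> : y ^+ 2 / a / 2 = y `^ 2%:R * a `^ (-1) * 2 `^ (-1).
      by rewrite powR_mulrn ?(ltW y0)// !powR_inv1 ?(ltW a0).
    rewrite !powRM ?mulr_ge0 ?powR_ge0// -!powRrM !mulN1r !opprK mulrN mulNr.
    by ring.
  have e3 : y / a * (a `^ mu * y `^ (- 2 * mu)) = a `^ (mu - 1) * y `^ (1 - 2 * mu).
    have -> : mu - 1 = - 1 + mu by ring.
    have -> : 1 - 2 * mu = 1 + - 2 * mu by ring.
    rewrite !powRD ?(gt_eqF y0) ?(gt_eqF a0) ?implybT//.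
    by rewrite (powRr1 (ltW y0)) (powR_inv1 (ltW a0)); ring.
  transitivity (((y / x) `^ (- mu) * z `^ (- mu)) * (y / a) * L *
    expR (- ((x ^+ 2 + y ^+ 2) / (2 * a)))); first by ring.
  rewrite e1 e2.
  transitivity (2 `^ mu * (y / a * (a `^ mu * y `^ (- 2 * mu))) * L *
    expR (- ((x ^+ 2 + y ^+ 2) / (2 * a)))); first by ring.
  rewrite e3 /bessel_lead; field; exact: lt0r_neq0.
have gL1 : 1 <= gammaR (1 - mu) * L by rewrite -ler_pdivrMl// mulr1.
have gL2 : gammaR (1 - mu) * L <= expR (z ^+ 2 / (1 - mu)).
  by rewrite mulrC -ler_pdivlMr.
split.
  by rewrite -mulrA ler_pM2l// ler_peMl// expR_ge0.
move=> yle; rewrite -mulrA ger_pMr//.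
apply: (@le_trans _ _ (expR (z ^+ 2 / (1 - mu)) * expR (- ((x ^+ 2 + y ^+ 2) / (2 * a))))).
  by rewrite ler_wpM2r ?expR_ge0.
rewrite -expRD expR_le1 subr_le0.
have -> : z ^+ 2 / (1 - mu) = x ^+ 2 / (2 * a) * (y ^+ 2 / (2 * (1 - mu) * a)).
  by rewrite /z; field; rewrite !lt0r_neq0.
apply: (@le_trans _ _ (x ^+ 2 / (2 * a))).
  apply: ler_piMr; first by rewrite divr_ge0 ?sqr_ge0 ?mulr_ge0 ?(ltW a0).
  have q0 : 0 < 2 * (1 - mu) * a by apply: mulr_gt0 => //; apply: mulr_gt0.
  by rewrite ler_pdivrMr// mul1r.
by rewrite ler_wpM2r ?invr_ge0 ?mulr_ge0 ?(ltW a0)// lerDl sqr_ge0.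
Qed.

Lemma bessel_lead_ge0 mu a y : 0 <= bessel_lead mu a y.
Proof. by rewrite !mulr_ge0 ?powR_ge0 ?invr_ge0 ?gammaR_ge0. Qed.

Lemma measurable_bessel_lead mu a (D : set R) :
  measurable_fun D (fun y : R => (bessel_lead mu a y)%:E).
Proof.
by apply/measurable_EFinP; apply: measurable_funTS; apply: measurable_funM.
Qed.

Lemma integral_bessel_lead mu a eta : 0 < mu < 1 -> 0 < a -> 0 < eta ->
  (\int[lebesgue_measure]_(y in `]0%R, eta]) (bessel_lead mu a y)%:E =
   (2 `^ mu / gammaR (1 - mu) / (2 - 2 * mu) * eta `^ (2 - 2 * mu) * a `^ (mu - 1))%:E)%E.
Proof.
move=> /andP[mu0 mu1] a0 eta0.
have mp : measurable_fun `]0, eta[ (fun y : R => (y `^ (2 - 2 * mu - 1))%:E).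
  by apply/measurable_EFinP; apply: measurable_funTS; exact: measurable_powR.
have leadE : (fun y => (bessel_lead mu a y)%:E) = (fun y =>
    (2 `^ mu / gammaR (1 - mu) * a `^ (mu - 1))%:E * (y `^ (2 - 2 * mu - 1))%:E)%E.
  by apply/funext => y; rewrite -EFinM /bessel_lead; congr (_ * _ `^ _)%:E; ring.
rewrite leadE -integral_itv_bndo_bndc; last exact: measurable_funeM.
rewrite ge0_integralZl_EFin//; last 2 first.
- by move=> y _; rewrite lee_fin powR_ge0.
- by rewrite mulr_ge0 ?powR_ge0// divr_ge0 ?powR_ge0// gammaR_ge0.
rewrite integral_powR_itv//; last by lra.
by rewrite -EFinM; congr EFin; ring.
Qed.

End bessel.

(** * Small ball bounds from the Markov property of the Bessel process *)

Section bessel_process_small_balls.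
Context {R : realType} {d : measure_display} {T : measurableType d}.
Variables (P : probability T R) (X : R -> {RV P >-> R}) (mu : R).
Hypotheses (mu01 : 0 < mu < 1) (bX : bessel_process (2 * (1 - mu)) 0 X).

Let delta : R := 2 * (1 - mu).

(* If [gammaR (1 - mu)] were 0 (it is if the integral diverges), the transition
   density from 0 would vanish by division by 0, and could not have mass 1. *)
Lemma bessel_gamma_gt0 : 0 < gammaR (1 - mu).
Proof.
have [X0 cX pX markov] := bX.
rewrite lt_neqAle gammaR_ge0 andbT eq_sym; apply/eqP => g0.
have F0 : natural_filtration X 0 (X 0 @^-1` [set 0]).
  by apply: natural_filtration_preimage; rewrite ?lexx.
have := markov 0 1 _ setT (lexx 0) ltr01 F0 (@measurableT _ R).
have -> : X 0 @^-1` [set 0] `&` X (0 + 1) @^-1` setT = [set w | X 0 w = 0].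
  by rewrite preimage_setT setIT.
rewrite X0 integral0_eq; first by move=> /eqP; rewrite onee_eq0.
move=> w /= X0w; rewrite /bessel_transition X0w.
apply: integral0_eq => y _; rewrite /bessel_density eqxx.
have -> : 2 * (1 - mu) / 2 - 1 + 1 = 1 - mu by field.
by rewrite g0 invr0 mulr0 !mul0r.
Qed.

Let C : R := 2 `^ mu / gammaR (1 - mu) / (2 - 2 * mu).

Lemma bessel_small_const_gt0 : 0 < C.
Proof.
have /andP[mu0 mu1] := mu01.
by rewrite !divr_gt0 ?powR_gt0 ?bessel_gamma_gt0//; lra.
Qed.

Let transition_small s a eta A : 0 <= s < a -> natural_filtration X s A ->
  (P (A `&` small X a eta) =
   \int[P]_(w in A) \int[lebesgue_measure]_(y in `]0%R, eta])
     (bessel_density delta (a - s) (X s w) y)%:E)%E.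
Proof.
move=> /andP[s0 sa] FA; have [X0 cX pX markov] := bX.
have := markov s (a - s) A `[- eta, eta]%classic s0 _ FA (measurable_itv _).
rewrite subr_gt0 addrC subrK => /(_ sa).
rewrite small_preimage => ->; apply: eq_integral => w _.
rewrite /bessel_transition; congr integral.
apply/seteqP; split => y /=; rewrite !in_itv/= andbT.
  by move=> [/andP[_ ->] ->].
move=> /andP[y0 ye]; rewrite y0 ye andbT; split => //.
by rewrite (le_trans _ (ltW y0))// oppr_le0 (le_trans (ltW y0)).
Qed.

(** On [A] the path lies in [[0, e]] at time [s], so [x ^ 2 + y ^ 2 <= (e + eta) ^ 2]. Measurability
    of the inner integral in the starting point is not established, which is why the comparison uses
    [ge0_le_integral_nomeas]. *)
Lemma bessel_small_ball_ge : small_ball_ge X mu C.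
Proof.
have [X0 cX pX markov] := bX.
move=> s a e eta A sa e0 eta0 FA Ae; rewrite (transition_small eta sa FA).
have /andP[s0 {}sa] := sa; have as0 : 0 < a - s by rewrite subr_gt0.
have mA : measurable A by exact: natural_filtration_measurable FA.
rewrite -integral_cst//; apply: ge0_le_integral_nomeas => w Aw.
  rewrite lee_fin; apply: mulr_ge0; last exact: expR_ge0.
  apply: mulr_ge0; last exact: powR_ge0.
  by apply: mulr_ge0; [exact: ltW bessel_small_const_gt0|exact: powR_ge0].
rewrite EFinM -integral_bessel_lead// muleC -ge0_integralZl_EFin ?expR_ge0//; last 2 first.
- by move=> y _; rewrite lee_fin bessel_lead_ge0.
- exact: measurable_bessel_lead.
apply: ge0_le_integral_nomeas => y /=; rewrite in_itv/= => /andP[y0 ye].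
  by rewrite -EFinM lee_fin mulr_ge0 ?expR_ge0 ?bessel_lead_ge0.
have x0 := pX s w s0; have xe : X s w <= e by rewrite -(ger0_norm x0); exact: Ae.
have [h _] := bessel_density_bounds mu01 bessel_gamma_gt0 as0 x0 y0.
rewrite -EFinM lee_fin mulrC; apply: le_trans h.
rewrite ler_wpM2l ?bessel_lead_ge0// ler_expR lerN2 ler_wpM2r//.
  by rewrite invr_ge0 mulr_ge0 ?(ltW as0).
by nra.
Qed.

Lemma bessel_small_ball_le : small_ball_le X mu C (2 * (1 - mu)).
Proof.
have [X0 cX pX markov] := bX.
move=> s a eta A sa eta0 etar FA; rewrite (transition_small eta sa FA).
have /andP[s0 {}sa] := sa; have as0 : 0 < a - s by rewrite subr_gt0.
have mA : measurable A by exact: natural_filtration_measurable FA.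
have dens0 w y : 0 < y -> (0 <= (bessel_density delta (a - s) (X s w) y)%:E)%E.
  move=> y0; rewrite lee_fin.
  have [h _] := bessel_density_bounds mu01 bessel_gamma_gt0 as0 (pX s w s0) y0.
  by apply: le_trans h; rewrite mulr_ge0 ?expR_ge0 ?bessel_lead_ge0.
rewrite -integral_cst//; apply: ge0_le_integral_nomeas => w Aw.
  apply: integral_ge0 => y /=; rewrite in_itv/= => /andP[y0 ye].
  exact: dens0.
rewrite -integral_bessel_lead//; apply: ge0_le_integral_nomeas => y /=;
  rewrite in_itv/= => /andP[y0 ye].
  exact: dens0.
have [_ h] := bessel_density_bounds mu01 bessel_gamma_gt0 as0 (pX s w s0) y0.
rewrite lee_fin; apply: h; apply: le_trans etar.
by rewrite lerXn2r ?nnegrE ?(ltW y0) ?(ltW eta0).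
Qed.

End bessel_process_small_balls.

(** * Small ball estimates for Brownian motion *)

Section independent_pair.
Context {R : realType} {d : measure_display} {T : measurableType d}.
Variables (P : probability T R) (N : probability (measurableTypeR R) R).

(** On [A], the joint law of [X] and [Y] agrees with a product measure on rectangles, hence
    everywhere. For Brownian motion this plays the part of the Markov property. *)
Lemma law_independent_pair (A : set T) (X Y : T -> measurableTypeR R) :
  measurable A -> measurable_fun setT X -> measurable_fun setT Y ->
  (forall U V : set (measurableTypeR R), measurable U -> measurable V ->
    P (A `&` (X @^-1` U `&` Y @^-1` V)) = (P (A `&` X @^-1` U) * N V)%E) ->
  exists2 m : {measure set (measurableTypeR R) -> \bar R},
    (forall U, m U = P (A `&` X @^-1` U)) &
    forall W : set (measurableTypeR R * measurableTypeR R), measurable W ->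
      P (A `&` (fun w => (X w, Y w)) @^-1` W) = (\int[m]_x N (xsection W x))%E.
Proof.
move=> mA mX mY ind.
have mXY : measurable_fun setT (fun w => (X w, Y w)).
  by apply/measurable_fun_pairP; split.
have [m0 m0E] := pushforward_measure (mrestr P mA) mX.
have m0fin : fin_num_fun m0.
  move=> U mU; rewrite m0E /pushforward /mrestr fin_num_measure//.
  by rewrite -[X in measurable X]setTI; exact: mX.
pose f : set (measurableTypeR R) -> \bar R := m0.
pose fM := HB.pack_for {measure set (measurableTypeR R) -> \bar R} f
  (isMeasure.Build _ _ _ f (measure0 m0) (measure_ge0 m0) (@measure_semi_sigma_additive _ _ _ m0)).
pose m1 := HB.pack_for {finite_measure set (measurableTypeR R) -> \bar R} f
  (isMeasure.Build _ _ _ f (measure0 m0) (measure_ge0 m0) (@measure_semi_sigma_additive _ _ _ m0))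
  (Measure_isFinite.Build _ _ _ fM m0fin).
have m1E U : m0 U = P (A `&` X @^-1` U) by rewrite m0E /pushforward /mrestr setIC.
have [m2 m2E] := pushforward_measure (mrestr P mA) mXY.
exists m0 => // W mW.
have -> : P (A `&` (fun w => (X w, Y w)) @^-1` W) = m2 W.
  by rewrite m2E /pushforward /mrestr setIC.
rewrite -(@product_measure_unique _ _ _ _ R m1 N m2)// => U V mU mV.
rewrite m2E /pushforward /mrestr [LHS](_ : _ = P (A `&` (X @^-1` U `&` Y @^-1` V))).
  by rewrite ind// -m1E.
by rewrite setIC.
Qed.

End independent_pair.

Section brownian_small_balls.
Context {R : realType} {d : measure_display} {T : measurableType d}.
Variables (P : probability T R) (B : R -> {RV P >-> R}).
Hypothesis bB : brownian_motion B.

Let mu : R := 2^-1.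
Let C : R := 2 / Num.sqrt (pi *+ 2).

Lemma brownian_small_const_gt0 : 0 < C.
Proof. by rewrite divr_gt0// sqrtr_gt0 pmulrn_lgt0// pi_gt0. Qed.

(** At [mu = 1/2] the small ball estimate is the peak of the Gaussian density times the length
    [2 * eta] of the window; this is where [C] comes from. *)
Let peakE (v eta : R) : 0 < v -> 0 < eta ->
  normal_peak (Num.sqrt v) * (2 * eta) = C * eta `^ (2 - 2 * mu) * v `^ (mu - 1).
Proof.
move=> v0 eta0; rewrite /normal_peak sqr_sqrtr ?(ltW v0)// -mulrnAr sqrtrM ?(ltW v0)//.
have -> : 2 - 2 * mu = 1 by rewrite /mu mulfV// addrK.
have -> : mu - 1 = - mu by rewrite /mu; field.
rewrite powRr1 ?(ltW eta0)// powRN powR12_sqrt ?(ltW v0)// invfM /C.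
ring.
Qed.

Let normal_pdf_sqrt (v y : R) : 0 < v ->
  normal_pdf 0 (Num.sqrt v) y = normal_peak (Num.sqrt v) * expR (- (y ^+ 2 / (2 * v))).
Proof.
move=> v0; have sv : Num.sqrt v != 0 by rewrite gt_eqF// sqrtr_gt0.
rewrite normal_pdfE// /normal_fun subr0 sqr_sqrtr ?(ltW v0)// mulNr.
by rewrite -mulr_natl.
Qed.

Let measure_window (x eta : R) : 0 < eta ->
  lebesgue_measure (`[(- eta - x)%R, (eta - x)%R] : set R) = (2 * eta)%:E.
Proof.
move=> eta0; rewrite lebesgue_measure_itv/= lte_fin ifT; last by lra.
by rewrite -EFinD; congr EFin; ring.
Qed.

Let normal_window_le (v x eta : R) : 0 < v -> 0 < eta ->
  (normal_prob 0 (Num.sqrt v) `[(- eta - x)%R, (eta - x)%R] <=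
   (C * eta `^ (2 - 2 * mu) * v `^ (mu - 1))%:E)%E.
Proof.
move=> v0 eta0; rewrite -peakE// EFinM -(measure_window x eta0) -integral_cst//.
apply: ge0_le_integral_nomeas => y _; first by rewrite lee_fin normal_pdf_ge0.
rewrite lee_fin normal_pdf_sqrt// ler_piMr ?normal_peak_ge0// expR_le1.
by rewrite oppr_le0 divr_ge0 ?sqr_ge0// mulr_ge0 ?(ltW v0).
Qed.

Let normal_window_ge (v x e eta : R) : 0 < v -> 0 < eta -> `|x| <= e ->
  ((C * eta `^ (2 - 2 * mu) * v `^ (mu - 1) * expR (- ((e + eta) ^+ 2 / (2 * v))))%:E <=
   normal_prob 0 (Num.sqrt v) `[(- eta - x)%R, (eta - x)%R])%E.
Proof.
move=> v0 eta0 xe; rewrite -peakE// mulrAC EFinM -(measure_window x eta0) -integral_cst//.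
apply: ge0_le_integral_nomeas => y /=; rewrite in_itv/= => /andP[y1 y2].
  by rewrite lee_fin mulr_ge0 ?normal_peak_ge0 ?expR_ge0.
rewrite lee_fin normal_pdf_sqrt// ler_wpM2l ?normal_peak_ge0// ler_expR lerN2.
rewrite ler_wpM2r ?invr_ge0 ?mulr_ge0 ?(ltW v0)//.
have e0 : 0 <= e by exact: le_trans xe.
by move: xe; rewrite ler_norml => /andP[x1 x2]; nra.
Qed.

Let brownian_small s a eta A : 0 <= s < a -> natural_filtration B s A ->
  exists2 m : {measure set (measurableTypeR R) -> \bar R},
    (forall U, m U = P (A `&` B s @^-1` U)) &
    P (A `&` small B a eta) = (\int[m]_x
      normal_prob 0 (Num.sqrt (a - s)) `[(- eta - x)%R, (eta - x)%R])%E.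
Proof.
move=> /andP[s0 sa] FA; have [B0 cB inc] := bB.
have mA : measurable A by exact: natural_filtration_measurable FA.
have mBs : @measurable_fun _ _ T (measurableTypeR R) setT (B s) by exact: (measurable_funPT (B s)).
have mI : @measurable_fun _ _ T (measurableTypeR R) setT (fun w => B a w - B s w).
  by apply: measurable_funB; [exact: (measurable_funPT (B a))|exact: (measurable_funPT (B s))].
have [|m mE mW] := @law_independent_pair R d T P (normal_prob 0 (Num.sqrt (a - s))) A _ _ mA mBs mI.
  move=> U V mU mV; rewrite setIA; apply: inc => //.
  apply: natural_filtrationI => //; apply: natural_filtration_preimage => //.
  by rewrite s0 lexx.
exists m => //.
pose W : set (R * R) := [set z | - eta <= z.1 + z.2 <= eta].
have mW' : measurable W.
  have mD : measurable_fun setT (fun z : R * R => z.1 + z.2).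
    exact: measurable_funD.
  rewrite (_ : W = setT `&` (fun z : R * R => z.1 + z.2) @^-1` `[- eta, eta]); last first.
    by rewrite setTI; apply/seteqP; split => z /=; rewrite in_itv.
  exact: mD.
have -> : A `&` small B a eta = A `&` (fun w => (B s w, B a w - B s w)) @^-1` W.
  by apply/seteqP; split => w []; rewrite /small /W /= addrC subrK ler_norml.
rewrite (mW _ mW'); apply: eq_integral => x _; congr (normal_prob _ _ _).
have wE (z y : R) : (- eta - z <= y <= eta - z) = (- eta <= z + y <= eta).
  by rewrite lerBlDl lerBrDl.
by apply/seteqP; split => y; rewrite /xsection /= in_itv/= wE ?inE.
Qed.

Lemma brownian_small_ball_ge : small_ball_ge B mu C.
Proof.
move=> s a e eta A sa e0 eta0 FA Ae.
have mA : measurable A by exact: natural_filtration_measurable FA.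
have [m mE ->] := brownian_small eta sa FA.
have v0 : 0 < a - s by rewrite subr_gt0; case/andP: sa.
(* [A] is contained in [small B s e], so all the mass of [m] sits on [[-e, e]], where the window
   bound holds. *)
have -> : P A = m `[- e, e]%classic.
  by rewrite mE -small_preimage setIidl.
rewrite -integral_cst// integral_mkcond; apply: ge0_le_integral_nomeas => x _.
  apply: erestrict_ge0 => y _; rewrite lee_fin; apply: mulr_ge0; last exact: expR_ge0.
  apply: mulr_ge0; last exact: powR_ge0.
  by apply: mulr_ge0; [exact: ltW brownian_small_const_gt0|exact: powR_ge0].
rewrite patchE; case: ifPn => [/set_mem|_]; last exact: measure_ge0.
by rewrite /= in_itv/= -ler_norml => xe; exact: normal_window_ge.
Qed.

Lemma brownian_small_ball_le r : small_ball_le B mu C r.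
Proof.
move=> s a eta A sa eta0 _ FA.
have [m mE ->] := brownian_small eta sa FA.
have v0 : 0 < a - s by rewrite subr_gt0; case/andP: sa.
have -> : P A = m setT by rewrite mE preimage_setT setIT.
rewrite -integral_cst//; apply: ge0_le_integral_nomeas => x _.
  exact: measure_ge0.
exact: normal_window_le.
Qed.

End brownian_small_balls.

(** * Normalisation and the law of the last zero *)

Section last_zero_law.
Context {R : realType} {d : measure_display} {T : measurableType d}.
Variables (P : probability T R) (Z : R -> {RV P >-> R}).

Lemma eq_has_density01 (g : T -> R) (f h : R -> R) :
  (forall t, 0 < t < 1 -> f t = h t) -> has_density01 P g f -> has_density01 P g h.
Proof.
move=> fh [mg gf]; split => // U mU; rewrite gf//.
by apply: eq_integral => t; rewrite inE/= in_itv/= => -[_ t01]; rewrite fh.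
Qed.

Lemma has_density_beta_dens (mu C r : R) : 0 < mu < 1 -> 0 < C -> 0 < r ->
  small_ball_ge Z mu C -> small_ball_le Z mu C r ->
  continuous_paths Z -> P [set w | Z 0 w = 0] = 1%E ->
  has_density01 P (last_zero Z) (fun t => sin (mu * pi) / pi * beta_dens mu t).
Proof.
move=> mu01 C0 r0 hge hle cZ Z0.
have s0 := sin_pi_gt0 mu01; have p0 := pi_gt0 R.
have k0 : 0 < sin (mu * pi) / pi by rewrite divr_gt0// mulrC.
have kB : sin (mu * pi) / pi * (pi / sin (pi * mu)) = 1.
  by rewrite (mulrC mu) mulrA divfK ?divff ?gt_eqF.
have kint D : measurable D ->
    (\int[lebesgue_measure]_(t in D) (sin (mu * pi) / pi * beta_dens mu t)%:E =
     (sin (mu * pi) / pi)%:E * \int[lebesgue_measure]_(t in D) (beta_dens mu t)%:E)%E.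
  move=> mD; under eq_integral do rewrite EFinM.
  apply: ge0_integralZl_EFin => //; last exact: ltW.
    by move=> t _; rewrite lee_fin beta_dens_ge0.
  by apply/measurable_EFinP; apply: measurable_funTS; exact: measurable_beta_dens.
apply: has_density_last_zero => //.
- by apply: measurable_funM => //; exact: measurable_beta_dens.
- by move=> x; rewrite mulr_ge0 ?beta_dens_ge0// ltW.
- move=> t t01; rewrite kint// -(prob_zero_in cZ mu01 C0 r0 hge hle Z0 t01).
  by rewrite damped_beta0 integral_beta_dens// muleCA -EFinM kB mule1.
- by rewrite kint// integral_beta_dens// -EFinM kB.
- exact: prob_small_one0 hle.
Qed.

Lemma betaR_reflection (mu : R) : 0 < mu < 1 -> betaR mu (1 - mu) = pi / sin (pi * mu).
Proof.
move=> mu01; rewrite /betaR /Rintegral -[RHS]/(fine (pi / sin (pi * mu))%:E).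
rewrite -integral_beta_dens//; congr fine; apply: eq_integral => x _.
by rewrite /beta_dens; congr (_ * _ `^ _)%:E; ring.
Qed.

End last_zero_law.

Theorem corollary2p11 (R : realType) (d : measure_display)
    (T : measurableType d) (P : probability T R) :
  (forall (mu : R) (X : R -> {RV P >-> R}),
     0 < mu < 1 ->
     bessel_process (2 * (1 - mu)) 0 X ->
     has_density01 P (last_zero X)
       (fun t => sin (mu * pi) / pi * (t `^ (1 - mu) * (1 - t) `^ mu)^-1) /\
     has_density01 P (last_zero X) (betaR_pdf mu (1 - mu)))
  /\
  (forall B : R -> {RV P >-> R},
     brownian_motion B ->
     has_density01 P (last_zero B)
       (fun t => pi^-1 * (Num.sqrt (t * (1 - t)))^-1)).
Proof.
split=> [mu X mu01 bX|B bB].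
- have [X0 cX _ _] := bX.
  have mu1 : 0 < 2 * (1 - mu) by rewrite mulr_gt0// subr_gt0; case/andP: mu01.
  have dX := has_density_beta_dens mu01 (bessel_small_const_gt0 mu01 bX) mu1
    (bessel_small_ball_ge mu01 bX) (bessel_small_ball_le mu01 bX) cX X0.
  split; apply: eq_has_density01 dX => t /andP[t0 t1].
    congr (_ * _); rewrite /beta_dens invfM -!powRN; congr (_ `^ _ * _).
    by ring.
  rewrite /betaR_pdf betaR_reflection// invf_div [LHS]mulrC (mulrC mu) /beta_dens.
  by congr (_ * _ `^ _ * _); ring.
- have [B0 cB _] := bB.
  have h01 : 0 < (2^-1 : R) < 1 by lra.
  (* The Gaussian upper bound holds for every [r]; the value 1 is an arbitrary positive choice. *)
  have dB := has_density_beta_dens h01 (@brownian_small_const_gt0 R) ltr01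
    (brownian_small_ball_ge bB) (@brownian_small_ball_le _ _ _ _ _ bB 1) cB B0.
  apply: eq_has_density01 dB => t /andP[t0 t1].
  rewrite (mulrC _ pi) sin_pihalf mul1r /beta_dens.
  have -> : 2^-1 - 1 = - 2^-1 :> R by field.
  have t1' : 0 <= 1 - t by rewrite subr_ge0 ltW.
  rewrite !powRN !powR12_sqrt ?(ltW t0)//.
  by rewrite sqrtrM ?(ltW t0)// invfM mulrC.
Qed.
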